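(* Let $f:[0,1]\to[0,1]$ be a continuous surjective function. Then the inverse limit $\varprojlim f$ is an arc if and only if $f$ does not admit a splitting sequence.
   Context: For a continuous $f:[0,1]\to[0,1]$, the inverse limit is $\varprojlim f=\{\mathbf x=(x_0,x_1,\dots)\in[0,1]^{\mathbb N}: f(x_{n+1})=x_n\text{ for all }n\in\mathbb N\}$ with the topology inherited from the product topology. An arc is a continuum homeomorphic to $[0,1]$. A sequence $(T_n)_{n\in\mathbb N}$ of closed intervals $T_n\subsetneq[0,1]$ (possibly degenerate) is tight (for $f$) if $f(T_{n+1})=T_n$ for every $n$ and there is $m\in\mathbb N$ such that $T_n$ is nondegenerate for all $n>m$. A tight sequence $(T_n)_{n\in\mathbb N}$, $T_n=[l_n,r_n]$, is a splitting sequence admitted by $f$ if there exist an infinite set $N\subseteq\mathbb N$ and nondegenerate closed intervals $S_n\subseteq[0,1]$ ($n\in N$) such that for each $n\in N$, $S_n\cap T_n\subseteq\{l_n,r_n\}$ and $f(S_n)=f(T_n)$. ''$f$ admits a splitting sequence'' means such a sequence exists. *)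

(* Defs.v *)
From HB Require Import structures.
From mathcomp Require Import all_boot all_order all_algebra.
From mathcomp Require Import all_classical all_reals all_analysis.
Set Implicit Arguments. Unset Strict Implicit. Unset Printing Implicit Defensive.
Import Order.TTheory GRing.Theory Num.Theory.
Import numFieldNormedType.Exports.
Local Open Scope classical_set_scope.
Local Open Scope ring_scope.

Definition cI {R : realType} (a b : R) : set R := [set x | a <= x <= b].

Definition homeomorphic {T U : topologicalType} (A : set T) (B : set U) : Prop :=
  exists (h : T -> U) (g : U -> T),
    {within A, continuous h} /\ {within B, continuous g} /\
    (forall x, A x -> B (h x)) /\ (forall y, B y -> A (g y)) /\
    (forall x, A x -> g (h x) = x) /\ (forall y, B y -> h (g y) = y).

Definition inv_lim {R : realType} (f : R -> R) : set {ptws nat -> R} :=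
  [set x | (forall n, 0 <= x n <= 1) /\ (forall n, f (x n.+1) = x n)].

Definition is_arc {R : realType} {T : topologicalType} (X : set T) : Prop :=
  homeomorphic (cI (0 : R) 1) X.

Definition proper_subinterval {R : realType} (l r : R) : Prop :=
  0 <= l /\ l <= r /\ r <= 1 /\ ~ (l = 0 /\ r = 1).

Definition tight {R : realType} (f : R -> R) (l r : nat -> R) : Prop :=
  (forall n, proper_subinterval (l n) (r n)) /\
  (forall n, f @` cI (l n.+1) (r n.+1) = cI (l n) (r n)) /\
  (exists m : nat, forall n, (m < n)%N -> l n < r n).

Definition splitting_sequence {R : realType} (f : R -> R) (l r : nat -> R) : Prop :=
  tight f l r /\
  exists (N : set nat) (a b : nat -> R),
    infinite_set N /\
    forall n, N n ->
      [/\ 0 <= a n, a n < b n, b n <= 1,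
          cI (a n) (b n) `&` cI (l n) (r n) `<=` [set l n; r n] &
          f @` cI (a n) (b n) = f @` cI (l n) (r n)].

Definition admits_splitting_sequence {R : realType} (f : R -> R) : Prop :=
  exists l r : nat -> R, splitting_sequence f l r.

(* Main.v *)
Require Import Defs.
From HB Require Import structures.
From mathcomp Require Import all_boot all_order all_algebra.
From mathcomp Require Import all_classical all_reals all_analysis.
From mathcomp Require Import lra.
Import Order.TTheory GRing.Theory Num.Theory.
Import numFieldNormedType.Exports.
Local Open Scope classical_set_scope.
Local Open Scope ring_scope.

(* Call [u, v] a crossing of [a, b] under g if g sends the end points of [u, v] to
   those of [a, b] and its interior into the interior. Crossings are the minimal
   lifts of [a, b]; two different ones do not overlap, and crossings of composites
   are iterated crossings.

   No splitting sequence => arc. The crossings of a fixed [a, b] under the iterates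
   of f form a finitely branching tree without leaves. A branch with infinitely many
   branching nodes is a splitting sequence, so without splitting sequences Koenig's
   lemma gives a level m beyond which the tree does not branch. A loop of f^j (an
   interval [x, z] with f^j x = f^j z) cannot then contain a crossing of [a, b]
   under f^(m+j): it would traverse the image of this crossing in level m twice.
   Applied to a fine grid of intervals [a, b], this says that for every e there is m
   such that f^m shrinks the f^j-images of all loops of f^j, j arbitrary, to
   diameter at most e. Hence long iterates of f are, up to a small error visible in
   lower levels, homeomorphisms (slightly tilted running maxima), and as in Brown's
   theorem on near-homeomorphisms the inverse limit is parametrized by the uniform
   limits phi_k of f^(n_i - k) o psi_i for suitable homeomorphisms psi_i of [0, 1].

   Arc => no splitting sequence. The subcontinuum determined by a tight sequence
   (T_n) is a nondegenerate subarc. Points whose n-th coordinates agree are close for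
   n large, so the points over S_{n+1} that project in level n to two given interior
   points of the subarc lie on it, whence S_{n+1} and T_{n+1} overlap. *)

Set Implicit Arguments. Unset Strict Implicit. Unset Printing Implicit Defensive.

(** * Uniform continuity *)

Section RealLemmas.
Variable R : realType.
Implicit Types (g h : R -> R) (a b x y z t : R).

(** The retraction of the line onto [[0, 1]]. Composition with it makes a map given on [[0, 1]]
    total, so that composites and iterates carry no domain conditions. *)
Definition clamp x : R := Num.max 0 (Num.min 1 x).

Lemma clampI x : 0 <= clamp x <= 1.
Proof. by rewrite /clamp le_max lexx/= ge_max ler01 ge_min lexx. Qed.

Lemma clamp_id {x} : 0 <= x <= 1 -> clamp x = x.
Proof.
by move=> /andP[x0 x1]; rewrite /clamp min_r // max_r.
Qed.

Lemma clamp_lip x y : `|clamp x - clamp y| <= `|x - y|.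
Proof.
have := ler_norm (x - y); have := ler_norm (y - x); rewrite distrC ler_norml.
rewrite /clamp !(maxEle, minEle).
by case: (leP 1 x) => ? /=; case: (leP 1 y) => ? /=; do 3 ?[case: (leP 0) => ? /=]; lra.
Qed.

Lemma clamp_homo x y : x <= y -> clamp x <= clamp y.
Proof.
by move=> xy; rewrite /clamp ge_max !le_max !le_min !ge_min !lexx xy !orbT.
Qed.

Definition unif_cont g := forall e : R, 0 < e -> exists2 d : R, 0 < d &
  forall x y, `|x - y| <= d -> `|g x - g y| <= e.

Lemma unif_cont_id : unif_cont id.
Proof. by move=> e e0; exists e. Qed.

Lemma unif_cont_lip g c : (forall x y, `|g x - g y| <= c * `|x - y|) -> unif_cont g.
Proof.
move=> gc e e0; have c0 : 0 < `|c| + 1 by rewrite ltr_wpDl.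
exists (e / (`|c| + 1)); first by rewrite divr_gt0.
move=> x y; rewrite ler_pdivlMr // => xy; apply: le_trans xy.
apply: le_trans (gc _ _) _; rewrite mulrC ler_wpM2l //.
by rewrite (le_trans (ler_norm _)) // lerDl.
Qed.

Lemma unif_cont_clamp : unif_cont clamp.
Proof. by apply: (@unif_cont_lip _ 1) => x y; rewrite mul1r clamp_lip. Qed.

Lemma unif_cont_comp g h : unif_cont g -> unif_cont h -> unif_cont (g \o h).
Proof.
move=> gu hu e /gu[d d0 gd]; have [c c0 hc] := hu d d0.
by exists c => // x y /hc/gd.
Qed.

Lemma unif_cont_iter g n : unif_cont g -> unif_cont (iter n g).
Proof.
move=> gu; elim: n => [|n IH]; first exact: unif_cont_id.
exact: (unif_cont_comp gu IH).
Qed.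

Lemma unif_cont_iter_le g n : unif_cont g -> forall e : R, 0 < e ->
  exists2 d : R, 0 < d & forall k x y, (k <= n)%N -> `|x - y| <= d ->
    `|iter k g x - iter k g y| <= e.
Proof.
move=> gu e e0; elim: n => [|n [d d0 IH]].
  by exists e => // k x y; rewrite leqn0 => /eqP ->.
have [c c0 gc] := unif_cont_iter n.+1 gu e0.
exists (Num.min c d); first by rewrite lt_min c0.
move=> k x y; rewrite leq_eqVlt le_min => /orP[/eqP -> | kn] /andP[xc xd].
  exact: gc.
by apply: IH.
Qed.

Lemma unif_cont_continuous g : unif_cont g -> continuous g.
Proof.
move=> gu x; apply/cvgrPdist_le => e /gu[d d0 gd].
near=> y; apply: gd; near: y.
by apply: cvgr_dist_le.
Unshelve. all: by end_near. Qed.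

Lemma ivt {g a b v} : continuous g -> a <= b ->
  (g a <= v <= g b) || (g b <= v <= g a) -> exists2 c, a <= c <= b & g c = v.
Proof.
move=> gc ab gv.
have := @IVT R g a b v ab (continuous_subspaceT gc).
rewrite ge_min le_max => /(_ _)[|c]; last first.
  by rewrite in_itv/= => *; exists c.
by case/orP: gv => /andP[-> ->]; rewrite ?orbT.
Qed.

(** Compactness of the unit square in the form used below: a sequence of bad pairs accumulates
    somewhere. *)
Lemma cluster_pair (u v : nat -> R) :
  (forall n, 0 <= u n <= 1) -> (forall n, 0 <= v n <= 1) ->
  exists a b, [/\ 0 <= a <= 1, 0 <= b <= 1 & forall (d : R) N, 0 < d ->
    exists n, [/\ (N <= n)%N, `|u n - a| < d & `|v n - b| < d]].
Proof.
move=> uI vI.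
have K := compact_setX (@segment_compact R 0 1) (@segment_compact R 0 1).
have [|[a b] [[/= aI bI] ab]] := K ((fun n => (u n, v n)) @ \oo) _.
  by exists 0%N => // n _ /=; rewrite !in_itv/= uI vI.
exists a, b; split => [||d N d0]; rewrite ?in_itv//= in aI bI *.
have := ab [set (u n, v n) | n in [set n | (N <= n)%N]] (ball (a, b) d).
case.
- by exists N => // n /= Nn; exists n.
- exact: nbhsx_ballx.
move=> _ [[n /= Nn <-] [/= ua vb]]; exists n; split=> //; rewrite distrC //.
Qed.

(** Bad pairs at scale [1/(n+1)] would accumulate at a pair with equal coordinates, against
    continuity there. *)
Lemma heine g : continuous g -> unif_cont (g \o clamp).
Proof.
move=> gc e e0; apply: contrapT => H.
have {}H n : exists xy : R * R, `|xy.1 - xy.2| <= n.+1%:R^-1 /\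
    e < `|g (clamp xy.1) - g (clamp xy.2)|.
  apply: contrapT => H'; apply: H; exists n.+1%:R^-1; first by rewrite invr_gt0.
  move=> x y xy; rewrite leNgt; apply/negP => exy; apply: H'.
  by exists (x, y).
have [xy xyP] := choice H.
have [a [b [_ _ ab]]] := @cluster_pair (clamp \o (fst \o xy)) (clamp \o (snd \o xy))
  (fun n => clampI _) (fun n => clampI _).
have ba (d : R) : 0 < d -> `|a - b| <= d.
  move=> d0.
  have d3 : 0 < d / 3 by lra.
  have [N /= NP] := ltr_add_invr d3.
  have [n [Nn /= un vn]] := ab _ N d3.
  have xyd : `|clamp (xy n).1 - clamp (xy n).2| < d / 3.
    rewrite add0r in NP; apply: le_lt_trans NP.
    apply: le_trans (clamp_lip _ _) (le_trans (xyP n).1 _).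
    by rewrite lef_pV2 ?posrE // ler_nat ltnS.
  have := ler_distD (clamp (xy n).1) a b.
  have := ler_distD (clamp (xy n).2) (clamp (xy n).1) b.
  rewrite (distrC a (clamp _)); lra.
have {}ba : a = b.
  apply/eqP; rewrite -subr_eq0 -normr_le0; apply/ler_addgt0Pr => d d0.
  by rewrite add0r ba.
have e2 : 0 < e / 2 by lra.
have /cvgrPdist_lt/(_ _ e2)/nbhs_ballP[d /= d0 dP] := gc a.
have [n [_ /= un vn]] := ab d 0%N d0.
have := dP (clamp (xy n).1); rewrite /ball/= distrC => /(_ un).
have := dP (clamp (xy n).2); rewrite /ball/= distrC ba => /(_ vn).
have := (xyP n).2.
have := ler_distD (g b) (g (clamp (xy n).1)) (g (clamp (xy n).2)).
rewrite (distrC _ (g b)); lra.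
Qed.

Lemma ex_uniform_bound (P : nat -> nat -> Prop) n :
  (forall i m m', (m <= m')%N -> P i m -> P i m') ->
  (forall i, (i < n)%N -> exists m, P i m) ->
  exists m, forall i, (i < n)%N -> P i m.
Proof.
move=> mono; elim: n => [|n IH] H; first by exists 0%N.
have [m mP] := IH (fun i ni => H i (ltnW ni)).
have [m' m'P] := H n (ltnSn n).
exists (maxn m m') => i; rewrite ltnS leq_eqVlt => /orP[/eqP -> | /mP Pim].
  exact: mono (leq_maxr _ _) m'P.
exact: mono (leq_maxl _ _) Pim.
Qed.

End RealLemmas.

(** * Crossings *)

Section Crossings.
Variable R : realType.
Implicit Types (g h k : R -> R) (a b x y z t u v : R).

(** [v] is the infimum of the points where [g] is at least [b]. The value there is not below [b] by
    continuity, and not above it by the intermediate value theorem. *)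
Lemma first_hit g x y b : continuous g -> x <= y -> g x < b -> b <= g y ->
  exists v, [/\ x < v <= y, g v = b & forall t, x <= t < v -> g t < b].
Proof.
move=> gc xy gx gy; pose S := [set t | x <= t <= y /\ b <= g t].
have Sy : S y by rewrite /S/= xy lexx.
have Sx : has_lbound S by exists x => t [/andP[]].
have Si : has_inf S by split => //; exists y.
have lt_inf t : x <= t < inf S -> g t < b.
  move=> /andP[xt tS]; rewrite ltNge; apply/negP => bt.
  have : inf S <= t.
    by apply: ge_inf => //; split => //; rewrite xt (le_trans (ltW tS)) ?ge_inf.
  by rewrite leNgt tS.
have xS : x <= inf S by apply: lb_le_inf; [exists y | move=> t [/andP[]]].
have Sley : inf S <= y by exact: ge_inf.
have bS : b <= g (inf S).
  rewrite leNgt; apply/negP => gS.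
  have d0 : 0 < b - g (inf S) by rewrite subr_gt0.
  have /cvgrPdist_lt/(_ _ d0)/nbhs_ballP[d /= dp dP] := gc (inf S).
  have [t [/andP[xt ty] bt] td] := inf_adherent dp Si.
  have St : inf S <= t by apply: ge_inf => //; split; rewrite ?xt.
  have /dP : ball (inf S) d t.
    by rewrite /ball/= distrC ger0_norm ?subr_ge0// ltrBlDl.
  by rewrite distrC => /ltr_normlW; rewrite ltrD2r ltNge bt.
exists (inf S); split.
- rewrite Sley andbT lt_neqAle xS andbT; apply/eqP => xE.
  by move: bS; rewrite -xE leNgt gx.
- apply/eqP; rewrite eq_le bS andbT leNgt; apply/negP => Sb.
  have [|c /andP[xc cS] gcb] := @ivt R g x (inf S) b gc xS.
    by rewrite (ltW gx) bS.
  have [cE|cN] := eqVneq c (inf S); first by rewrite -cE gcb ltxx in Sb.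
  have := lt_inf c; rewrite gcb ltxx xc lt_neqAle cN cS => /(_ isT).
  by [].
- exact: lt_inf.
Qed.

Lemma continuous_opp g : continuous g -> continuous (fun t => - g t).
Proof. by move=> gc t; apply: cvgN; exact: gc. Qed.

Lemma continuous_flip g : continuous g -> continuous (fun t => - g (- t)).
Proof.
move=> gc; apply: continuous_opp => t.
by apply: continuous_comp; [exact: opp_continuous|exact: gc].
Qed.

Definition cross g u v a b := [/\ 0 <= u, u < v, v <= 1,
  (g u = a /\ g v = b) \/ (g u = b /\ g v = a) &
  forall t, u < t < v -> a < g t < b].

Lemma cross_up g x y a b : continuous g -> 0 <= x -> y <= 1 -> x <= y ->
  a < b -> g x <= a -> b <= g y ->
  exists u v, [/\ x <= u, v <= y & cross g u v a b].
Proof.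
move=> gc x0 y1 xy ab gx gy.
have [v [/andP[xv vy] gv vP]] := first_hit gc xy (le_lt_trans gx ab) gy.
have xvN : - v <= - x by rewrite lerN2 ltW.
(* The last point before [v] with value [a] is a first hit for the graph rotated by a half turn. *)
have [||w [/andP[vw wx] gw wP]] := @first_hit _ _ _ (- a) (continuous_flip gc) xvN.
- by rewrite opprK gv ltrN2.
- by rewrite opprK lerN2.
exists (- w), v; split; rewrite 1?lerNr//.
split.
- by rewrite (le_trans x0)// lerNr.
- by rewrite ltrNl.
- exact: le_trans y1.
- by left; rewrite -gv; split => //; apply: oppr_inj.
move=> t /andP[wt tv]; apply/andP; split.
  rewrite -ltrN2 -[t]opprK wP// lerN2 (ltW tv)/=; lra.
by apply: vP; rewrite tv andbT; lra.
Qed.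

Lemma cross_exists g x y a b : continuous g -> 0 <= x -> y <= 1 -> x <= y ->
  a < b -> (g x <= a /\ b <= g y) \/ (b <= g x /\ g y <= a) ->
  exists u v, [/\ x <= u, v <= y & cross g u v a b].
Proof.
move=> gc x0 y1 xy ab [[gx gy]|[gx gy]]; first exact: cross_up.
have [|||u [v [xu vy [u0 uv v1 guv gt]]]] := @cross_up (fun t => - g t) x y (- b) (- a)
  (continuous_opp gc) x0 y1 xy; rewrite ?ltrN2 ?lerN2//.
exists u, v; split => //; split => //.
  case: guv => -[/oppr_inj ? /oppr_inj ?]; tauto.
by move=> t /gt; rewrite !ltrN2 andbC.
Qed.

(** An end point of one crossing inside the other would have value [a] or [b], where a value
    strictly in between is required. *)
Lemma cross_unique g u v u' v' a b : cross g u v a b -> cross g u' v' a b ->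
  u < v' -> u' < v -> u = u' /\ v = v'.
Proof.
move=> [u0 uv v1 guv gt] [u0' uv' v1' guv' gt'] uv'' u'v.
have nout (h : R -> R) c d c' d' : (h c' = a /\ h d' = b) \/ (h c' = b /\ h d' = a) ->
    (forall t, c < t < d -> a < h t < b) -> ~ (c < c' < d) /\ ~ (c < d' < d).
  by move=> [[hc hd]|[hc hd]] H; split => /H; rewrite ?hc ?hd ltxx ?andbF.
have [A B] := nout _ _ _ _ _ guv' gt.
have [C D] := nout _ _ _ _ _ guv gt'.
split; apply/eqP; rewrite eq_le !leNgt; apply/andP; split; apply/negP => H.
- by apply: C; rewrite H.
- by apply: A; rewrite H.
- by apply: B; rewrite H andbT.
- by apply: D; rewrite H andbT.
Qed.

Lemma cross_neq g u v u' v' a b : cross g u v a b -> cross g u' v' a b ->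
  ~ (u = u' /\ v = v') -> v <= u' \/ v' <= u.
Proof.
move=> C C' N; case: (leP v u') => [|vu]; [by left|right].
by rewrite leNgt; apply/negP => uv; apply: N; exact: (cross_unique C C' uv vu).
Qed.

Lemma cross_comp g k u v u' v' a b :
  cross g u v a b -> cross k u' v' u v -> cross (g \o k) u' v' a b.
Proof.
move=> [u0 uv v1 guv gt] [u0' uv' v1' kuv kt]; split => //; last by move=> t /kt/gt.
by case: kuv => -[/= -> ->]; tauto.
Qed.

Lemma cross_lt g u v a b : cross g u v a b -> a < b.
Proof.
move=> [u0 uv v1 guv gt].
have /gt/andP[] : u < (u + v) / 2 < v by lra.
exact: lt_trans.
Qed.

(** The intermediate crossing has end points [k u'] and [k v']. Inside [[u', v']] the map [k] never
    takes these two values, since [g \o k] would then be [a] or [b]; hence it stays strictly between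
    them. *)
Lemma cross_factor g k u' v' a b : continuous k ->
  (forall t, 0 <= t <= 1 -> 0 <= k t <= 1) -> cross (g \o k) u' v' a b ->
  exists u v, cross g u v a b /\ cross k u' v' u v.
Proof.
move=> kc kI C; have ab := cross_lt C; case: C => u0' uv' v1' guv gt.
have g_end t : k t = k u' \/ k t = k v' -> ~ (u' < t < v').
  move=> [] E /gt /=; rewrite E; move: guv => /=.
    by case=> -[-> _]; rewrite ltxx ?andbF.
  by case=> -[_ ->]; rewrite ltxx ?andbF.
have kne : k u' <> k v'.
  by move=> E; case: guv => /= -[]; rewrite E => -> H; rewrite H ltxx in ab.
have no_cross t : u' < t < v' -> (k u' < k t < k v') \/ (k v' < k t < k u').
  move=> /andP[ut tv]; apply: contrapT => N.
  (* If [k t] is not strictly between the end values, then on the way from [u'] to [t] the map [k]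
     meets [k v'], or on the way from [t] to [v'] it meets [k u']. *)
  have [Hu|Hv] : (k u' <= k v' <= k t \/ k t <= k v' <= k u') \/
      (k v' <= k u' <= k t \/ k t <= k u' <= k v').
  - have ge := g_end t; rewrite ut tv in ge.
    have [H1|H1|H1] := ltgtP (k u') (k t); have [H2|H2|H2] := ltgtP (k v') (k t);
      try (by exfalso; apply: ge => //; first [left; congruence | right; congruence]).
    + by have [H3|H3] := leP (k u') (k v'); [left; left|right; left];
        rewrite ?H3 ?(ltW H3) ?(ltW H1) ?(ltW H2).
    + by case: N; left; apply/andP; split.
    + by case: N; right; apply/andP; split.
    + by have [H3|H3] := leP (k u') (k v'); [right; right|left; right];
        rewrite ?H3 ?(ltW H3) ?(ltW H1) ?(ltW H2).
  - have [|c /andP[uc ct] kcv] := @ivt R k u' t (k v') kc (ltW ut); first by apply/orP; tauto.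
    apply: (g_end c); first by right.
    rewrite (le_lt_trans ct tv) andbT lt_neqAle uc andbT.
    by apply/eqP => E; apply: kne; rewrite E.
  - have [|c /andP[tc cv] kcu] := @ivt R k t v' (k u') kc (ltW tv); first by apply/orP; tauto.
    apply: (g_end c); first by left.
    rewrite (lt_le_trans ut tc) /= lt_neqAle cv andbT.
    by apply/eqP => E; apply: kne; rewrite -E.
have hit s : (k u' < s < k v') || (k v' < s < k u') -> a < g s < b.
  move=> H.
  have [|c /andP[uc cv] kcs] := @ivt R k u' v' s kc (ltW uv').
    by case/orP: H => /andP[/ltW -> /ltW ->]; rewrite ?orbT.
  rewrite -kcs; apply: gt; rewrite !lt_neqAle uc cv !andbT.
  apply/andP; split; apply/eqP => E; move: H; rewrite -kcs.
    by rewrite -E ltxx andbF.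
  by rewrite E ltxx andbF.
have /andP[ku0 ku1] : 0 <= k u' <= 1 by apply: kI; lra.
have /andP[kv0 kv1] : 0 <= k v' <= 1 by apply: kI; lra.
case: (ltgtP (k u') (k v')) => // kuv.
- exists (k u'), (k v'); split; split => //.
  + by move=> t tt; apply: hit; rewrite tt.
  + by left.
  + by move=> t /no_cross[//|/andP[A B]]; have := lt_trans A B; rewrite ltNge ltW.
- exists (k v'), (k u'); split; split => //.
  + by move: guv => /=; tauto.
  + by move=> t tt; apply: hit; rewrite tt orbT.
  + by right.
  + by move=> t /no_cross[/andP[A B]|//]; have := lt_trans A B; rewrite ltNge ltW.
Qed.

Lemma cross_image g u v a b : continuous g -> cross g u v a b ->
  g @` cI u v = cI a b.
Proof.
move=> gc C; have ab := cross_lt C; case: C => u0 uv v1 guv gt.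
rewrite eqEsubset; split => [_ [t /andP[ut tv] <-]|s /= sab]; rewrite /cI/=.
  have [->|tu] := eqVneq t u; first by case: guv => -[-> _]; rewrite lexx ltW.
  have [->|tv'] := eqVneq t v; first by case: guv => -[_ ->]; rewrite lexx ltW.
  have /gt/andP[/ltW -> /ltW ->//] : u < t < v by rewrite !lt_neqAle ut tv tv' eq_sym tu.
have [|c cuv gcs] := @ivt R g u v s gc (ltW uv); last by exists c.
by have {}sab : a <= s <= b := sab; case: guv => -[-> ->]; rewrite sab ?orbT.
Qed.

End Crossings.

(** * The tree of crossings *)

Lemma infinite_natP (N : set nat) :
  infinite_set N <-> forall n, exists2 m, N m & (n <= m)%N.
Proof.
split=> [Ninf n|unb].
  apply: contrapT => H; apply: Ninf; apply: sub_finite_set (finite_II n) => m Nm /=.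
  by rewrite ltnNge; apply/negP => nm; apply: H; exists m.
move=> /finite_seqP[s Ns].
have [m Nm] := unb (\max_(i <- s) i).+1.
apply/negP; rewrite -leqNgt.
have ms : m \in s by move: Nm; rewrite Ns.
exact: (@leq_bigmax_seq _ s xpredT id).
Qed.

Lemma bucket (R : realType) (d x : R) N : 0 <= x -> x < N%:R * d ->
  exists i, [/\ (i < N)%N, i%:R * d <= x & x < i.+1%:R * d].
Proof.
move=> x0; elim: N => [|N IH]; first by rewrite mul0r ltNge x0.
move=> xN; have [/IH[i [iN ? ?]]|Nx] := ltP x (N%:R * d).
  by exists i; split => //; exact: ltnW.
by exists N.
Qed.

Section Lifts.
Variables (R : realType) (f : R -> R).
Hypothesis fu : unif_cont f.
Hypothesis fI : forall x : R, 0 <= f x <= 1.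
Hypothesis fs : forall y : R, 0 <= y <= 1 -> exists2 x : R, 0 <= x <= 1 & f x = y.
Implicit Types (a b u v x y z : R).

Let fc : continuous f := unif_cont_continuous fu.

Lemma iter_continuous n : continuous (iter n f).
Proof. exact: unif_cont_continuous (unif_cont_iter n fu). Qed.

Lemma iter_I n x : 0 <= x <= 1 -> 0 <= iter n f x <= 1.
Proof. by case: n => //= n _; exact: fI. Qed.

Lemma iter_surj n y : 0 <= y <= 1 -> exists2 x, 0 <= x <= 1 & iter n f x = y.
Proof.
elim: n y => [|n IH] y yI; first by exists y.
have [x xI <-] := fs yI; have [z zI <-] := IH _ xI.
by exists z.
Qed.

Lemma iterDfun m n : iter (m + n) f = iter m f \o iter n f.
Proof. by apply/funext => x; rewrite iterD. Qed.

Lemma cross_iter_factor m n u v a b : cross (iter (m + n) f) u v a b ->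
  exists u' v', cross (iter m f) u' v' a b /\ cross (iter n f) u v u' v'.
Proof.
rewrite iterDfun; apply: cross_factor; first exact: iter_continuous.
by move=> t; exact: iter_I.
Qed.

Lemma cross_iter_comp m n u v u' v' a b :
  cross (iter m f) u' v' a b -> cross (iter n f) u v u' v' ->
  cross (iter (m + n) f) u v a b.
Proof. by rewrite iterDfun; exact: cross_comp. Qed.

Lemma cross_iter0 u v a b : cross (iter 0 f) u v a b -> u = a /\ v = b.
Proof.
move=> C; have ab := cross_lt C; case: C => /= _ uv _ [[-> ->]//|[uE vE]] _.
by move: uv; rewrite uE vE ltNge (ltW ab).
Qed.

Definition unique_lifts a b := forall j u v u' v',
  cross (iter j f) u v a b -> cross (iter j f) u' v' a b -> u = u' /\ v = v'.

(* The tree of crossings of [a, b] does not branch beyond level [m]. *)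
Definition stable_lifts m a b := forall u v,
  cross (iter m f) u v a b -> unique_lifts u v.

Lemma stable_lifts_le m m' a b : (m <= m')%N ->
  stable_lifts m a b -> stable_lifts m' a b.
Proof.
move=> /subnKC <- H u v /cross_iter_factor[u1 [v1 [/H H1 C]]].
by move=> j u2 v2 u3 v3 C2 C3; apply: (H1 (m' - m + j)%N); exact: cross_iter_comp C _.
Qed.

(** Finite branching: by uniform continuity all crossings of [[a, b]] are longer than some [d], so
    each interval [[i * d, (i + 1) * d)] contains at most one left end point, and the finitely many
    children have a common stable level. *)
Lemma stable_lifts_step a b : a < b ->
  (forall u v, cross f u v a b -> exists m, stable_lifts m u v) ->
  exists m, stable_lifts m a b.
Proof.
move=> ab H.
have ab2 : 0 < (b - a) / 2 by lra.
have [d d0 fd] := fu ab2.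
have long u v : cross f u v a b -> d < v - u.
  move=> [_ uv _ fuv _]; rewrite ltNge; apply/negP => vud.
  have /fd : `|v - u| <= d by rewrite gtr0_norm ?subr_gt0.
  case: fuv => -[-> ->]; first by rewrite gtr0_norm ?subr_gt0 //; lra.
  by rewrite distrC gtr0_norm ?subr_gt0 //; lra.
pose P i m := forall u v, cross f u v a b -> i%:R * d <= u -> u < i.+1%:R * d ->
  stable_lifts m u v.
have [N Nd] : exists N, 1 < N%:R * d.
  have [N /= NP] := ltr_add_invr d0; exists N.+1.
  by move: NP; rewrite add0r -div1r ltr_pdivrMr // mulrC.
have [|i iN|m mP] := @ex_uniform_bound P N.
- by move=> i m m' mm' Pm u v C i1 i2; apply: stable_lifts_le mm' _; exact: Pm.
- have [[[u v] [C i1 i2]]|none] := pselect (exists p : R * R,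
      [/\ cross f p.1 p.2 a b, i%:R * d <= p.1 & p.1 < i.+1%:R * d]); last first.
    by exists 0%N => u v C i1 i2; exfalso; apply: none; exists (u, v).
  have [m Hm] := H _ _ C; exists m => u' v' C' i1' i2' /=.
  rewrite /= in i1 i2 C Hm.
  have [[<- <-]//|N'] := pselect (u = u' /\ v = v').
  move: i2 i2'; rewrite -natr1 mulrDl mul1r => i2 i2'.
  have := long _ _ C; have := long _ _ C'.
  case: (cross_neq C C' N'); lra.
exists m.+1; rewrite -add1n => u v /cross_iter_factor[u' [v' [C C']]].
have [u0 uv' v1 _ _] := C.
have [||i [iN i1 i2]] := @bucket R d u' N; [by []|lra|].
exact: (mP i iN u' v' C i1 i2).
Qed.

Hypothesis nosplit : ~ admits_splitting_sequence f.

(** From level [M] on each node of the branch [T] has a single child, so by induction the only node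
    [j] levels above [T M] is [T (M + j)]. *)
Lemma unique_lifts_chain (T : nat -> R * R) M :
  (forall n, cross f (T n.+1).1 (T n.+1).2 (T n).1 (T n).2) ->
  (forall n q, (M <= n)%N -> cross f q.1 q.2 (T n).1 (T n).2 -> q = T n.+1) ->
  unique_lifts (T M).1 (T M).2.
Proof.
move=> TC TU j.
suff H u v : cross (iter j f) u v (T M).1 (T M).2 -> (u, v) = T (M + j)%N.
  by move=> u v u' v' /H E /H; rewrite -E => -[-> ->].
elim: j u v => [|j IH] u v.
  by rewrite addn0 => /cross_iter0[-> ->]; case: (T M).
rewrite -addn1 => /cross_iter_factor[u' [v' [/IH E C]]].
have /(TU (M + j)%N (u, v) (leq_addr _ _)) : cross f u v (T (M + j)%N).1 (T (M + j)%N).2.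
  by rewrite -E.
by move=> ->; rewrite addnA addn1.
Qed.

(** Koenig's lemma: a bad node has a bad child, which yields an infinite branch [T] of bad nodes. It
    has siblings in infinitely many levels, and these serve as the intervals of a splitting
    sequence. *)
Lemma exists_stable_lifts a b : 0 <= a -> a < b -> b <= 1 -> ~ (a = 0 /\ b = 1) ->
  exists m, stable_lifts m a b.
Proof.
move=> a0 ab b1 abN; apply: contrapT => bad0.
pose bad (p : R * R) := ~ exists m, stable_lifts m p.1 p.2.
have /choice[c cP] (p : R * R) : exists q : R * R, p.1 < p.2 -> bad p ->
    cross f q.1 q.2 p.1 p.2 /\ bad q.
  have [[q qP]|nq] := pselect (exists q : R * R, cross f q.1 q.2 p.1 p.2 /\ bad q).
    by exists q.
  exists p => plt; case; apply: stable_lifts_step => // u v C.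
  by apply: contrapT => H; apply: nq; exists (u, v).
pose T n := iter n c (a, b).
have [Tlt Tbad] : (forall n, (T n).1 < (T n).2) /\ forall n, bad (T n).
  apply: all_and2; elim => [//|n [IH1 IH2]].
  by have [[]] := cP _ IH1 IH2.
have TC n : cross f (T n.+1).1 (T n.+1).2 (T n).1 (T n).2.
  exact: (cP _ (Tlt n) (Tbad n)).1.
have TC0 n : cross (iter n f) (T n).1 (T n).2 a b.
  elim: n => [|n IH].
    by split=> //=; left.
  by have := @cross_iter_comp n 1 _ _ _ _ _ _ IH (TC n); rewrite addn1.
have TI n : 0 <= (T n).1 /\ (T n).2 <= 1 by have [] := TC0 n.
apply: nosplit; exists (fun n => (T n).1), (fun n => (T n).2); split.
  split; last split.
  (* If [T n] were [[0, 1]], its image [[a, b]] under the surjective [n]-th iterate would be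
     [[0, 1]] too. *)
  - move=> n; have [T0 T1] := TI n; split=> //; split; first exact: ltW.
    split=> // -[E0 E1]; apply: abN.
    have := cross_image (@iter_continuous n) (TC0 n); rewrite E0 E1 => E.
    have full y : 0 <= y <= 1 -> cI a b y.
      by move=> /(iter_surj n)[x xI <-]; rewrite -E; exists x.
    have /full/andP[a00 _] : 0 <= (0 : R) <= 1 by lra.
    have /full/andP[_ b11] : 0 <= (1 : R) <= 1 by lra.
    by split; apply/eqP; rewrite eq_le ?a00 ?b11 ?a0 ?b1.
  - by move=> n; exact: cross_image fc (TC n).
  - by exists 0%N => n _; exact: Tlt.
(* [q] is a sibling of [T n]. Level 0 is excluded from [N] because the root has no parent and [n.-1]
   would be the root itself. *)
pose other n (q : R * R) := cross f q.1 q.2 (T n.-1).1 (T n.-1).2 /\ q <> T n.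
pose N := [set n | (0 < n)%N /\ exists q, other n q].
have /choice[s sP] n : exists q, N n -> other n q.
  have [[_ [q qP]]|nn] := pselect (N n); first by exists q.
  by exists (a, b).
exists N, (fun n => (s n).1), (fun n => (s n).2); split.
  (* If no siblings occurred from level [M] on, [T M] would be stable already at level 0. *)
  apply/infinite_natP => M; apply: contrapT => H; apply: (Tbad M).
  exists 0%N => u v C.
  have [-> ->] := cross_iter0 C.
  apply: unique_lifts_chain => // n q Mn Cq; apply: contrapT => qN.
  by apply: H; exists n.+1; [split => //; exists q | exact: leqW].
move=> n Nn; have [C qT] := sP n Nn.
case: n Nn C qT => [[//]|n] Nn /= C qT.
split; [by case: C|by case: C|by case: C| |].
  move=> x [/andP[sx xs] /andP[tx xt]].
  have pair_ext (p q : R * R) : p.1 = q.1 -> p.2 = q.2 -> p = q.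
    by case: p; case: q => /= ? ? ? ? -> ->.
  have [|H|H] := cross_neq C (TC n).
  - by move=> [E1 E2]; apply: qT; exact: pair_ext.
  - by left; apply/eqP; rewrite eq_le tx (le_trans xs H).
  - by right; apply/eqP; rewrite eq_le xt (le_trans H sx).
by rewrite (cross_image fc C) (cross_image fc (TC n)).
Qed.

(** The path starts and ends at the same value outside the open interval from [a] to [b], so it has
    to traverse [[a, b]] once more, before [u] or after [v]. *)
Lemma crossing_loop j x z a b : 0 <= x -> z <= 1 -> x <= z ->
  iter j f x = iter j f z -> ~ (a < iter j f x < b) -> unique_lifts a b ->
  forall u v, x <= u -> v <= z -> ~ cross (iter j f) u v a b.
Proof.
move=> x0 z1 xz E pN U u v xu vz C.
have ab := cross_lt C; have [u0 uv v1 kuv _] := C.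
have left_lift : (iter j f x <= a /\ b <= iter j f u) \/
    (b <= iter j f x /\ iter j f u <= a) -> False.
  move=> H; have [|u2 [v2 [_ v2u C2]]] := cross_exists (@iter_continuous j) x0 _ xu ab H.
    by lra.
  by have [_ vE] := U _ _ _ _ _ C2 C; move: v2u; rewrite vE leNgt uv.
have right_lift : (iter j f v <= a /\ b <= iter j f z) \/
    (b <= iter j f v /\ iter j f z <= a) -> False.
  move=> H; have [|u2 [v2 [u2v _ C2]]] := cross_exists (@iter_continuous j) _ z1 vz ab H.
    by lra.
  by have [uE _] := U _ _ _ _ _ C2 C; move: u2v; rewrite uE leNgt uv.
have [pa|ap] := leP (iter j f x) a.
  case: kuv => -[ku kv]; last by apply: left_lift; left; rewrite ku.
  by apply: right_lift; right; rewrite kv -E.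
have bp : b <= iter j f x by rewrite leNgt; apply/negP => pb; apply: pN; rewrite ap.
case: kuv => -[ku kv]; first by apply: left_lift; right; rewrite ku.
by apply: right_lift; left; rewrite kv -E.
Qed.

(** The same [m] serves loops of all iterates. Distances are taken from the image of the end points,
    so the image of a loop has diameter at most [2 * e]. *)
Definition small_loops m (e : R) := forall j x y z, 0 <= x -> x <= y -> y <= z -> z <= 1 ->
  iter j f x = iter j f z -> `|iter (m + j) f y - iter (m + j) f x| <= e.

Lemma small_loops_le m m' e : (m <= m')%N -> small_loops m e -> small_loops m' e.
Proof.
move=> /subnKC <- H j x y z x0 xy yz z1 E; rewrite -addnA.
by apply: (H _ _ _ z) => //; rewrite !iterD E.
Qed.

Lemma grid_between N (s t : R) : 0 <= s -> t <= 1 -> s + 2 / N%:R <= t -> (0 < N)%N ->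
  exists i, [/\ (i < N)%N, s <= i%:R / N%:R & i.+1%:R / N%:R <= t].
Proof.
move=> s0 t1 st N0.
have NR : 0 < N%:R :> R by rewrite ltr0n.
have Ni : 0 < N%:R^-1 :> R by rewrite invr_gt0.
have [||i [iN i1 i2]] := @bucket R N%:R^-1 s N => //.
  by rewrite divff ?gt_eqF//; lra.
move: i1 i2; rewrite -natr1 mulrDl mul1r => i1 i2.
(* The cell following the one that contains [s]. *)
exists i.+1; rewrite -!natr1 !mulrDl !mul1r; split; [|lra|lra].
rewrite -(ltr_nat R) -natr1 -(ltr_pM2r Ni) mulrDl divff ?gt_eqF//; lra.
Qed.

(** A large excursion passes over a whole grid cell, hence contains a crossing of it under
    [f^(m+j)]. The level-[m] factor of this crossing has unique lifts, against [crossing_loop]. *)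
Lemma exists_small_loops e : 0 < e -> exists m, small_loops m e.
Proof.
move=> e0.
(* Two cells fit into length [e]; [1 < N] keeps each cell different from [[0, 1]], as
   [exists_stable_lifts] requires. *)
have [N N1 Ne] : exists2 N, (1 < N)%N & 2 / N%:R < e.
  have e2 : 0 < e / 2 by lra.
  have [N /= NP] := ltr_add_invr e2; exists N.+2 => //.
  have : N.+2%:R^-1 <= N.+1%:R^-1 :> R by rewrite lef_pV2 ?posrE // ler_nat.
  by move: NP; rewrite add0r; move: (_^-1) (N.+2%:R^-1) => c1 c2; lra.
have NR : 0 < N%:R :> R by rewrite ltr0n (ltn_trans _ N1).
have Ni : 0 < N%:R^-1 :> R by rewrite invr_gt0.
have [|i iN|m mP] := @ex_uniform_bound
    (fun i m => stable_lifts m (i%:R / N%:R) (i.+1%:R / N%:R)) N.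
- by move=> i m m'; exact: stable_lifts_le.
- apply: exists_stable_lifts.
  + by rewrite divr_ge0.
  + by rewrite ltr_pM2r // ltr_nat.
  + by rewrite ler_pdivrMr // mul1r ler_nat.
  + case=> /eqP; rewrite mulf_eq0 invr_eq0 (gt_eqF NR) orbF pnatr_eq0 => /eqP -> /eqP.
    by rewrite div1r invr_eq1 pnatr_eq1 => /eqP NE; rewrite NE in N1.
exists m => j x y z x0 xy yz z1 E; rewrite leNgt; apply/negP => big.
have xI : 0 <= x <= 1 by lra.
have yI : 0 <= y <= 1 by lra.
have /andP[sI0 sI1] := iter_I (m + j) xI.
have /andP[tI0 tI1] := iter_I (m + j) yI.
set s := iter (m + j) f x in big sI0 sI1; set t := iter (m + j) f y in big tI0 tI1.
have [i [iN [H|H]]] : exists i, (i < N)%N /\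
    ((s <= i%:R / N%:R /\ i.+1%:R / N%:R <= t) \/
     (i.+1%:R / N%:R <= s /\ t <= i%:R / N%:R)).
- have [st|ts] := leP s t.
    have [|i [iN i1 i2]] := @grid_between N s t sI0 tI1 _ (ltnW N1).
      by move: big; rewrite ger0_norm ?subr_ge0 //; lra.
    by exists i; split => //; left.
  have [|i [iN i1 i2]] := @grid_between N t s tI0 sI1 _ (ltnW N1).
    by move: big; rewrite ltr0_norm ?subr_lt0 //; lra.
  by exists i; split => //; right.
all: have ab : i%:R / N%:R < i.+1%:R / N%:R :> R by rewrite ltr_pM2r // ltr_nat.
all: have [||u [v [xu vy C]]] := cross_exists (@iter_continuous (m + j)) x0 _ xy ab (y := y);
  [lra|tauto|].
all: have [a' [b' [C1 C2]]] := cross_iter_factor C.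
all: apply: (crossing_loop x0 z1 (le_trans xy yz) E _ (mP i iN _ _ C1) xu (le_trans vy yz) C2).
(* The end value of the loop is not inside the level-[m] crossing, since its image [s] is not inside
   the cell. *)
all: case: C1 => _ _ _ _ H1 /H1; rewrite -iterD -/s; lra.
Qed.

End Lifts.

(** * Straightening maps with small loops *)

Section Straightening.
Variable R : realType.
Implicit Types (F g h p q : R -> R) (a b x y z t u v s d : R).

Definition between a b c := (a <= b <= c) || (c <= b <= a).

Definition uniformly_injective p := forall e : R, 0 < e -> exists2 c : R, 0 < c &
  forall s t, 0 <= s <= 1 -> 0 <= t <= 1 -> e <= `|s - t| -> c <= `|p s - p t|.

Definition monotone p := forall s u t, 0 <= s -> s <= u -> u <= t -> t <= 1 ->
  between (p s) (p u) (p t).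

(** Homeomorphisms of [[0, 1]], of either orientation and extended to the line; uniform injectivity
    is the uniform continuity of the inverse. *)
Definition param p := [/\ unif_cont p, forall s, 0 <= p s <= 1,
  forall y, 0 <= y <= 1 -> exists2 s, 0 <= s <= 1 & p s = y,
  uniformly_injective p & monotone p].

Lemma param_clamp : param (@clamp R).
Proof.
split; [exact: unif_cont_clamp|exact: clampI|..].
- by move=> y yI; exists y => //; rewrite clamp_id.
- by move=> e e0; exists e => // s t sI tI; rewrite !clamp_id.
- by move=> s u t s0 su ut t1; rewrite /between (clamp_homo su) (clamp_homo ut).
Qed.

Lemma param_comp p q : param p -> param q -> param (p \o q).
Proof.
move=> [pu pI ps pinj pm] [qu qI qs qinj qm]; split.
- exact: unif_cont_comp.
- by move=> s; exact: pI.
- by move=> y /ps[x /qs[s sI <-] <-]; exists s.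
- move=> e /qinj[c /pinj[d d0 dP] cP]; exists d => // s t sI tI st.
  exact/dP/cP.
- move=> s u t s0 su ut t1.
  have /andP[qs0 qs1] := qI s; have /andP[qt0 qt1] := qI t.
  case/orP: (qm s u t s0 su ut t1) => /andP[q1 q2].
    exact: pm.
  by rewrite /between orbC; exact: pm.
Qed.

Definition flip t : R := 1 - t.

Lemma param_flip p : param p -> param (flip \o p).
Proof.
rewrite /flip => -[pu pI ps pinj pm]; split.
- move=> e /pu[d d0 dP]; exists d => // x y /dP /=.
  have -> : 1 - p x - (1 - p y) = - (p x - p y) by lra.
  by rewrite normrN.
- by move=> s; have := pI s; rewrite /=; lra.
- move=> y yI; have [|s sI E] := ps (1 - y); first lra.
  by exists s => //=; rewrite E; lra.
- move=> e /pinj[c c0 cP]; exists c => // s t sI tI /(cP _ _ sI tI) /=.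
  have -> : 1 - p s - (1 - p t) = - (p s - p t) by lra.
  by rewrite normrN.
- move=> s u t s0 su ut t1; have := pm s u t s0 su ut t1.
  by rewrite /between /= !lerD2l !lerN2 => /orP[]/andP[-> ->]; rewrite ?orbT.
Qed.

(** Two such values become close under iterates that shrink loops. Either may be the value at the
    ends, as both cases occur for the running maximum. *)
Definition on_loop F a b := exists x y z, [/\ 0 <= x, x <= y, y <= z, z <= 1 &
  F x = F z /\ ((F x = a /\ F y = b) \/ (F x = b /\ F y = a))].

(* Here [h] is the running maximum of [F] from [x0] on; [on_loop F (h t) (F t)] holds
   because the graph must come back to the level of [F t] or of [h t]. *)
Lemma running_max F x0 x1 : unif_cont F -> (forall t, 0 <= t <= 1 -> 0 <= F t <= 1) ->
  0 <= x0 -> x0 < x1 -> x1 <= 1 -> F x0 = 0 -> F x1 = 1 ->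
  exists h, [/\ unif_cont h, {homo h : s t / s <= t}, h 0 = 0 /\ h 1 = 1,
    forall t, 0 <= t <= 1 -> on_loop F (h t) (F t) &
    forall s t, 0 <= s -> s <= t -> t <= 1 -> h s < h t ->
      exists u v, [/\ s <= u <= t, s <= v <= t & h t - h s <= F u - F v]].
Proof.
move=> Fu FI x00 x01 x11 F0 F1; have Fc := unif_cont_continuous Fu.
(* Confining [t] to [[x0, 1]] makes the maximum over [[x0, top t]] equal to [F x0 = 0] for [t]
   before [x0]. *)
pose top t := Num.max x0 (clamp t).
have topE t : x0 <= top t <= 1.
  have x01' : x0 <= 1 by lra.
  by rewrite /top le_max lexx ge_max x01' /=; have /andP[] := clampI t.
have top_homo s t : s <= t -> top s <= top t.
  move=> st; rewrite /top ge_max; apply/andP; split; rewrite le_max ?lexx //.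
  by rewrite (clamp_homo st) orbT.
pose A t := [set F s | s in [set s | x0 <= s <= top t]].
have AI t : ubound (A t) 1.
  move=> _ [s /= /andP[xs st] <-].
  have /FI/andP[//] : 0 <= s <= 1.
  by have /andP[_ t1] := topE t; rewrite (le_trans x00 xs) (le_trans st t1).
have An t : A t !=set0.
  by exists (F x0); exists x0 => //=; rewrite lexx; have /andP[] := topE t.
pose h t := sup (A t).
have Aub t : has_ubound (A t) by exists 1; exact: AI.
have leh s t : x0 <= s <= top t -> F s <= h t.
  by move=> st; apply: ub_le_sup => //; exists s.
have hle t c : (forall s, x0 <= s <= top t -> F s <= c) -> h t <= c.
  by move=> H; apply: ge_sup => // _ [s /= /H ? <-].
have hatt t : exists2 s, x0 <= s <= top t & F s = h t.
  have /andP[xt t1] := topE t.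
  have [s sI sM] := EVT_max xt (continuous_subspaceT Fc).
  rewrite in_itv/= in sI; exists s => //; apply/eqP; rewrite eq_le leh //=.
  by apply: hle => u uI; apply: sM; rewrite in_itv.
have hhomo : {homo h : s t / s <= t}.
  move=> s t st; apply: hle => u /andP[xu us]; apply: leh.
  by rewrite xu (le_trans us) // top_homo.
have topid t : 0 <= t <= 1 -> top t = Num.max x0 t by move=> tI; rewrite /top clamp_id.
have hlow t : 0 <= t -> t <= x0 -> h t = 0.
  move=> t0 tx; have tI : 0 <= t <= 1 by lra.
  have tE : top t = x0 by rewrite topid // max_l.
  apply/eqP; rewrite eq_le; apply/andP; split.
    apply: hle => s; rewrite tE => sx; have -> : s = x0 by lra.
    by rewrite F0.
  by rewrite -F0; apply: leh; rewrite tE !lexx.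
have hhigh t : x1 <= t -> t <= 1 -> h t = 1.
  move=> xt t1; have tI : 0 <= t <= 1 by lra.
  apply/eqP; rewrite eq_le; apply/andP; split; first exact: ge_sup.
  rewrite -F1; apply: leh; rewrite topid // max_r; lra.
exists h; split => //.
- move=> e e0; have [d d0 dP] := Fu e e0; exists d => // s t.
  have H u v : u <= v -> v - u <= d -> h v <= h u + e.
    move=> uv vud; apply: hle => w /andP[xw wv].
    have [wu|uw] := leP w (top u).
      have := leh w u; rewrite xw wu => /(_ isT); lra.
    have /andP[xu u1] := topE u.
    have := leh (top u) u; rewrite xu lexx => /(_ isT).
    suff /dP : `|w - top u| <= d by have := ler_norm (F w - F (top u)); lra.
    rewrite gtr0_norm ?subr_gt0 //.
    have cuv := clamp_lip v u; rewrite ger0_norm ?subr_ge0 ?clamp_homo // in cuv.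
    rewrite (ger0_norm (x := v - u)) ?subr_ge0 // in cuv.
    move: wv uw; rewrite /top !maxEle.
    by case: (leP x0 (clamp v)) => ? ; case: (leP x0 (clamp u)) => ?; lra.
  rewrite ler_norml => /andP[ld ud]; rewrite ler_norml.
  have [st|ts] := leP s t.
    have := H _ _ st ltac:(lra); have := hhomo _ _ st; lra.
  have := H _ _ (ltW ts) ltac:(lra); have := hhomo _ _ (ltW ts); lra.
- by split; [exact: hlow|exact: hhigh].
- move=> t tI; have /andP[t0 t1] := tI.
  have FtI := FI t tI.
  (* Three loops: before [x0], from [t] through [x0] to a return to [F t]; after [x1],
     symmetrically; in between, from a point where the maximum is attained through [t] to a return
     to [h t]. *)
  have [tx|xt] := leP t x0.
    have [|c /andP[xc cx] Fc'] := @ivt R F x0 x1 (F t) Fc (ltW x01).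
      by rewrite F0 F1 FtI.
    exists t, x0, c; split => //; first lra.
    by split; [rewrite Fc' | right; rewrite hlow].
  have [xt'|tx'] := leP x1 t.
    have [|c /andP[xc cx] Fc'] := @ivt R F x0 x1 (F t) Fc (ltW x01).
      by rewrite F0 F1 FtI.
    exists c, x1, t; split => //; first lra.
    by split => //; right; rewrite hhigh // F1.
  have [s /andP[xs st] Fs] := hatt t.
  have {}st : s <= t by move: st; rewrite topid // max_r // ltW.
  have hI : h t <= 1.
    by rewrite -Fs; have /FI/andP[] : 0 <= s <= 1 by lra.
  have Fh : F t <= h t.
    by apply: leh; rewrite topid // le_max lexx orbT (ltW xt).
  have [||c /andP[tc cx] Fc'] := @ivt R F t x1 (h t) Fc; first exact: ltW.
    by rewrite F1 Fh hI.
  exists s, t, c; split => //; [lra|lra|].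
  by split; [rewrite Fc' | left].
move=> s t s0 st t1 hst.
have sI : 0 <= s <= 1 by lra.
have tI : 0 <= t <= 1 by lra.
have xt : x0 < t.
  rewrite ltNge; apply/negP => tx; move: hst.
  by rewrite !hlow ?ltxx //; lra.
(* The maximum up to [t] is attained at some [w], which lies beyond [s] because [h s < h t]; at the
   maximum of [x0] and [s] the value of [F] is at most [h s]. *)
have [w /andP[xw wt] Fw] := hatt t.
have {}wt : w <= t by move: wt; rewrite topid // max_r // ltW.
have sw : s < w.
  rewrite ltNge; apply/negP => ws; move: hst; rewrite ltNge -Fw leh //.
  by rewrite xw topid // le_max ws orbT.
exists w, (Num.max x0 s); split.
- by rewrite wt ltW.
- by rewrite le_max lexx orbT ge_max st (ltW xt).
- by rewrite Fw lerB // leh // -topid // lexx andbT; have /andP[] := topE s.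
Qed.

(** The expansion bound makes the inverse [p] Lipschitz with constant [1/d]; uniform continuity of
    [g] becomes uniform injectivity of [p]. *)
Lemma strict_inverse g d : 0 < d -> unif_cont g -> g 0 = 0 -> g 1 = 1 ->
  (forall s t, 0 <= s -> s <= t -> t <= 1 -> d * (t - s) <= g t - g s) ->
  exists2 p, param p & forall s, 0 <= s <= 1 -> g (p s) = s.
Proof.
move=> d0 gu g0 g1 gd; have gc := unif_cont_continuous gu.
have /choice[p pP] s : exists t, 0 <= t <= 1 /\ g t = clamp s.
  have [|t tI gt] := @ivt R g 0 1 (clamp s) gc ler01; last by exists t.
  by rewrite g0 g1 clampI.
have pI s := (pP s).1; have gp s := (pP s).2.
have expand s t : d * `|p s - p t| <= `|clamp s - clamp t|.
  have [/andP[? ?] /andP[? ?]] := (pI s, pI t).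
  rewrite -!gp; have [st|ts] := leP (p s) (p t).
    rewrite distrC ger0_norm ?subr_ge0 // distrC.
    by apply: le_trans (ler_norm _); exact: gd.
  rewrite gtr0_norm ?subr_gt0 //.
  by apply: le_trans (ler_norm _); apply: gd => //; exact: ltW.
have pmono s t : s <= t -> p s <= p t.
  move=> st; rewrite leNgt; apply/negP => pts.
  have [/andP[? ?] /andP[? ?]] := (pI s, pI t).
  have := gd (p t) (p s) ltac:(lra) (ltW pts) ltac:(lra); rewrite !gp.
  have : 0 < d * (p s - p t) by rewrite mulr_gt0 ?subr_gt0.
  by have := clamp_homo st; lra.
exists p; last by move=> s sI; rewrite gp clamp_id.
split => //.
- apply: (@unif_cont_lip _ _ d^-1) => x y.
  rewrite ler_pdivlMl //; exact: le_trans (expand x y) (clamp_lip x y).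
- move=> y yI; have /andP[y0 y1] := yI; exists (g y).
    have := gd 0 y; have := gd y 1; rewrite g0 g1 !lexx.
    have : 0 <= d * (1 - y) by rewrite mulr_ge0 ?subr_ge0 // ltW.
    have : 0 <= d * (y - 0) by rewrite subr0 mulr_ge0 // ltW.
    by move=> A B /(_ y0 y1 isT) C /(_ isT y0 y1) D; lra.
  apply/eqP; rewrite -subr_eq0 -normr_le0 -(pmulr_rle0 _ d0).
  have gyI : 0 <= g y <= 1.
    have := gd 0 y; have := gd y 1; rewrite g0 g1 !lexx.
    have : 0 <= d * (1 - y) by rewrite mulr_ge0 ?subr_ge0 // ltW.
    have : 0 <= d * (y - 0) by rewrite subr0 mulr_ge0 // ltW.
    by move=> A B /(_ y0 y1 isT) C /(_ isT y0 y1) D; lra.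
  have E : g (p (g y)) = g y by rewrite gp clamp_id.
  have /andP[p0 p1] := pI (g y).
  have [st|ts] := leP (p (g y)) y.
    by rewrite distrC ger0_norm ?subr_ge0 //; have := gd _ _ p0 st y1; rewrite E subrr.
  by rewrite gtr0_norm ?subr_gt0 //; have := gd _ _ y0 (ltW ts) p1; rewrite E subrr.
- move=> e e0; have [c c0 cP] := gu (e / 2) ltac:(lra).
  exists c => // s t sI tI est; rewrite leNgt; apply/negP => /ltW/cP.
  by rewrite !gp !clamp_id //; lra.
- by move=> s u t s0 su ut t1; rewrite /between (pmono _ _ su) (pmono _ _ ut).
Qed.

(* [p] is the inverse of the tilted running maximum [(1 - d) h + d id]. *)
Lemma straighten_up F x0 x1 d : unif_cont F -> (forall t, 0 <= t <= 1 -> 0 <= F t <= 1) ->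
  0 <= x0 -> x0 < x1 -> x1 <= 1 -> F x0 = 0 -> F x1 = 1 -> 0 < d -> d < 1 ->
  exists p, [/\ param p,
    forall s, 0 <= s <= 1 -> exists2 r, `|r - s| <= d & on_loop F r (F (p s)) &
    forall s t, 0 <= s -> t <= 1 -> s + d < t -> exists u v,
      [/\ between (p s) u (p t), between (p s) v (p t) & t - s - d <= `|F u - F v|]].
Proof.
move=> Fu FI x00 x01 x11 F0 F1 d0 d1.
have [h [hu hh [h0 h1] hloop hosc]] := running_max Fu FI x00 x01 x11 F0 F1.
pose g t := (1 - d) * h t + d * t.
have hI t : 0 <= t <= 1 -> 0 <= h t <= 1.
  by move=> /andP[t0 t1]; rewrite -h0 -[X in _ <= _ <= X]h1 !hh.
have gh t : 0 <= t <= 1 -> `|h t - g t| <= d.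
  move=> tI; have := hI t tI.
  have -> : h t - g t = d * (h t - t) by rewrite /g; lra.
  move=> htI; rewrite normrM gtr0_norm // -[leRHS]mulr1 ler_wpM2l ?(ltW d0) //.
  by rewrite ler_norml; lra.
have [|||||p pp gp] := @strict_inverse g d => //.
- move=> e e0; have [c c0 cP] := hu (e / 2) ltac:(lra).
  exists (Num.min c (e / 2)); first by rewrite lt_min c0; lra.
  move=> x y; rewrite le_min => /andP[/cP xc xe].
  have -> : g x - g y = (1 - d) * (h x - h y) + d * (x - y) by rewrite /g; lra.
  apply: le_trans (ler_normD _ _) _;
  rewrite !normrM (gtr0_norm d0) (gtr0_norm (x := 1 - d)) ?subr_gt0 //.
  have A : (1 - d) * `|h x - h y| <= `|h x - h y| by rewrite ler_piMl //; lra.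
  have B : d * `|x - y| <= `|x - y| by rewrite ler_piMl // ltW.
  by lra.
- by rewrite /g h0 !mulr0 addr0.
- by rewrite /g h1 !mulr1; lra.
- move=> s t s0 st t1; have := hh _ _ st; rewrite /g => hst.
  have : 0 <= (1 - d) * (h t - h s) by rewrite mulr_ge0 ?subr_ge0 // ltW.
  by lra.
have [pu pI _ _ pm] := pp.
exists p; split => // [s sI|s t s0 t1 sdt].
  by exists (h (p s)); [rewrite -{2}(gp s sI); exact: gh|exact: hloop].
have sI : 0 <= s <= 1 by lra.
have tI : 0 <= t <= 1 by lra.
have [/andP[ps0 ps1] /andP[pt0 pt1]] := (pI s, pI t).
have pst : p s <= p t.
  rewrite leNgt; apply/negP => pts.
  have : g (p t) <= g (p s).
    have := hh _ _ (ltW pts) => H.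
    by rewrite /g lerD // ler_wpM2l ?subr_ge0 // ltW.
  by rewrite !gp //; lra.
(* The tilt contributes at most [d] to the increase [t - s] of [g]; the rest is due to [h]. *)
have gap : t - s - d <= h (p t) - h (p s).
  have E : t - s = (1 - d) * (h (p t) - h (p s)) + d * (p t - p s).
    by rewrite -{1}(gp t tI) -{1}(gp s sI) /g; lra.
  have := hh _ _ pst => H.
  have : 0 <= d * (h (p t) - h (p s)) by rewrite mulr_ge0 ?subr_ge0 // ltW.
  have : d * (p t - p s) <= d * 1 by rewrite ler_wpM2l ?(ltW d0) //; lra.
  by lra.
have [|u [v [ust vst uv]]] := hosc _ _ ps0 pst pt1; first by lra.
exists u, v; rewrite /between ust vst; split => //.
by rewrite (le_trans gap) // (le_trans uv) // ler_norm.
Qed.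

Lemma straighten F d : unif_cont F -> (forall t, 0 <= t <= 1 -> 0 <= F t <= 1) ->
  (forall y, 0 <= y <= 1 -> exists2 x, 0 <= x <= 1 & F x = y) -> 0 < d -> d < 1 ->
  exists p, [/\ param p,
    forall s, 0 <= s <= 1 -> exists2 r, `|r - s| <= d & on_loop F r (F (p s)) &
    forall s t, 0 <= s -> t <= 1 -> s + d < t -> exists u v,
      [/\ between (p s) u (p t), between (p s) v (p t) & t - s - d <= `|F u - F v|]].
Proof.
move=> Fu FI Fs d0 d1.
have [|x0 /andP[x00 x01] F0] := Fs 0; first lra.
have [|x1 /andP[x10 x11] F1] := Fs 1; first lra.
have [x01'|x10'|E] := ltgtP x0 x1; last by move: F0; rewrite E F1; lra.
  exact: (straighten_up Fu FI x00 x01' x11 F0 F1 d0 d1).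
(* When the value 1 is taken before the value 0, the domain is reflected. *)
have flipK t : flip (flip t) = t by rewrite /flip; lra.
have Fu' : unif_cont (F \o flip).
  apply: unif_cont_comp => //; apply: (@unif_cont_lip _ _ 1) => x y.
  have -> : flip x - flip y = - (x - y) by rewrite /flip; lra.
  by rewrite normrN mul1r.
have [||||||p [pp ploop posc]] :=
  @straighten_up (F \o flip) (flip x0) (flip x1) d Fu' _ _ _ _ _ _ d0 d1.
- by move=> t tI; apply: FI; rewrite /flip; lra.
- by rewrite /flip; lra.
- by rewrite /flip; lra.
- by rewrite /flip; lra.
- by rewrite /= flipK.
- by rewrite /= flipK.
exists (flip \o p); split; first exact: param_flip.
  move=> s /ploop[r rs [x [y [z [x0' xy yz z1 [E L]]]]]]; exists r => //.
  exists (flip z), (flip y), (flip x); rewrite /flip; split; try lra.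
  by split; [exact/esym|move: L E; rewrite /= /flip => L E; rewrite -E].
move=> s t s0 t1 st; have [u [v [pu pv uv]]] := posc s t s0 t1 st.
exists (flip u), (flip v); split => //.
  by move: pu; rewrite /between /= /flip !lerD2l !lerN2 => /orP[]/andP[-> ->]; rewrite ?orbT.
by move: pv; rewrite /between /= /flip !lerD2l !lerN2 => /orP[]/andP[-> ->]; rewrite ?orbT.
Qed.

End Straightening.

(** * The limit parametrization *)

(** Since [2 * e i <= 4 * (e i - e i.+1)], the increments telescope, so the intervals of radius
    [4 * e i] around [a i] meet pairwise; the supremum of their left ends lies in all of them. *)
Lemma quasi_cauchy (R : realType) (P : nat -> bool) (a e : nat -> R) :
  (exists i, P i) -> (forall i, P i -> P i.+1) -> (forall i, 0 < e i) ->
  (forall i, e i.+1 <= e i / 2) -> (forall i, P i -> `|a i - a i.+1| <= 2 * e i) ->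
  exists l, forall i, P i -> `|l - a i| <= 4 * e i.
Proof.
move=> [i0 Pi0] PS e0 eS aS.
have Pm i j : (i <= j)%N -> P i -> P j.
  by move=> /subnKC <-; elim: (j - i)%N => [|k IH]; rewrite ?addn0 ?addnS // => /IH/PS.
have dist i j : (i <= j)%N -> P i -> `|a j - a i| <= 4 * (e i - e j).
  move=> /subnKC <-; elim: (j - i)%N => [|k IH] Pi; first by rewrite addn0 !subrr normr0 mulr0.
  rewrite addnS; have := IH Pi; have := aS _ (Pm _ _ (leq_addr k i) Pi).
  have := eS (i + k)%N; have := ler_distD (a (i + k)%N) (a (i + k).+1) (a i).
  by rewrite (distrC (a (i + k).+1) (a (i + k)%N)); lra.
have meet i j : P i -> P j -> a i - 4 * e i <= a j + 4 * e j.
  move=> Pi Pj; have ei := e0 i; have ej := e0 j.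
  have [ij|/ltnW ji] := leqP i j.
    by have := dist _ _ ij Pi; rewrite ler_norml; lra.
  by have := dist _ _ ji Pj; rewrite ler_norml; lra.
pose A := [set a i - 4 * e i | i in [set i | P i]].
have Aub j : P j -> ubound A (a j + 4 * e j).
  by move=> Pj _ [i /= Pi <-]; exact: meet.
exists (sup A) => i Pi; rewrite ler_norml; apply/andP; split.
  have : a i - 4 * e i <= sup A.
    by apply: ub_le_sup; [exists (a i + 4 * e i); exact: Aub|exists i].
  by lra.
have : sup A <= a i + 4 * e i.
  by apply: ge_sup; [exists (a i - 4 * e i); exists i|exact: Aub].
by lra.
Qed.

Section Parametrization.
Variables (R : realType) (f : R -> R).
Hypothesis fu : unif_cont f.
Hypothesis fI : forall x : R, 0 <= f x <= 1.
Hypothesis fs : forall y : R, 0 <= y <= 1 -> exists2 x : R, 0 <= x <= 1 & f x = y.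
Hypothesis sl : forall e : R, 0 < e -> exists m, small_loops f m e.
Implicit Types (a b u v x y z s t : R) (p : R -> R).

(* [chart] is a homeomorphism of [0, 1] onto the copy of [0, 1] at [level]. The last two
   clauses of [refines] make the charts Cauchy in every level, and keep the limit
   from being constant on an interval. *)
Record stage := Stage { prev_level : nat; level : nat; tol : R; chart : R -> R }.

(** Loops at [level] are small when seen from [prev_level], so the next chart may move points along
    such loops. *)
Definition valid (S : stage) := [/\ (prev_level S <= level S)%N, 0 < tol S,
  param (chart S) & small_loops f (level S - prev_level S) (tol S)].

Definition refines (i : nat) (S T : stage) := [/\
  prev_level T = level S, (level S < level T)%N, tol T <= tol S / 2,
  forall k s, (k <= prev_level S)%N ->
    `|iter (level S - k) f (chart S s) - iter (level T - k) f (chart T s)| <= 2 * tol S &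
  forall s t, 0 <= s -> t <= 1 -> s + i.+1%:R^-1 <= t -> exists u v,
    [/\ s <= u <= t, s <= v <= t & 20 * tol T <=
    `|iter (level T - level S) f (chart T u) - iter (level T - level S) f (chart T v)|]].

(** The new chart is [q \o p], where [q] straightens [f^(m+1)]. *)
Lemma refine i S : valid S -> exists T, valid T /\ refines i S T.
Proof.
case: S => n' n tau p [/= n'n tau0 pp slS].
have [pu pI _ pinj pm] := pp.
have [eta i0 etaE] : exists2 eta : R, 0 < eta & eta = i.+1%:R^-1.
  by exists i.+1%:R^-1; rewrite ?invr_gt0.
have [c c0 cP] := pinj _ i0.
(* [c / 40] makes [20 * tau'] at most [c / 2], the oscillation that is left after subtracting
   [d <= c / 2]. *)
pose tau' := Num.min (tau / 2) (c / 40).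
have tau'0 : 0 < tau' by rewrite lt_min; lra.
have [tau'1 tau'2] : tau' <= tau / 2 /\ tau' <= c / 40.
  by split; rewrite /tau' ge_min lexx ?orbT.
have [m slm] := sl tau'0.
(* The successor makes the levels strictly increase. *)
have {}slm : small_loops f m.+1 tau' by exact: small_loops_le (leqnSn m) slm.
have [dl dl0 dlP] := unif_cont_iter_le n fu tau0.
(* [dl] hides the straightening error in lower levels, [c / 2] preserves oscillation, and [1 / 2]
   ensures [d < 1]. *)
pose d := Num.min dl (Num.min (c / 2) (1 / 2)).
have d0 : 0 < d by rewrite !lt_min; lra.
have [d1 d2 d3] : [/\ d <= dl, d <= c / 2 & d <= 1 / 2].
  by split; rewrite /d ?ge_min ?lexx ?orbT.
have [|||q [qp qloop qosc]] := @straighten R (iter m.+1 f) d (unif_cont_iter m.+1 fu) _ _ d0.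
- by move=> t; exact: iter_I.
- exact: iter_surj.
- by lra.
clearbody tau' d.
exists (Stage n (n + m.+1) tau' (q \o p)); split; split => //=.
- by rewrite leq_addr.
- exact: param_comp.
- by rewrite addnC addnK.
- by rewrite addnS ltnS leq_addr.
- move=> k s kn'.
  rewrite -(addnBAC m.+1 (leq_trans kn' n'n)).
  (* The error passes through [r]: [p s] is [d]-close to [r], and [r] shares a loop with the value
     of the new chart. Each part costs at most [tau]. *)
  have [r rd [x [y [z [x0 xy yz z1 [E L]]]]]] := qloop _ (pI s).
  have D1 : `|iter (n - k) f (p s) - iter (n - k) f r| <= tau.
    by apply: dlP; [exact: leq_subr|rewrite distrC (le_trans rd)].
  have sk : small_loops f (n - k) tau by apply: small_loops_le slS; exact: leq_sub2l.
  have D2 : `|iter (n - k) f r - iter (n - k) f (iter m.+1 f (q (p s)))| <= tau.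
    have := sk m.+1 x y z x0 xy yz z1 E; rewrite !(iterD (n - k)).
    by case: L => -[-> ->] //; rewrite distrC.
  have := ler_distD (iter (n - k) f r) (iter (n - k) f (p s))
    (iter (n - k) f (iter m.+1 f (q (p s)))).
  by rewrite (iterD (n - k)) /=; lra.
- move=> s t s0 t1; rewrite -etaE => st; rewrite addnC addnK.
  have sI : 0 <= s <= 1 by lra.
  have tI : 0 <= t <= 1 by lra.
  have cst : c <= `|p s - p t|.
    by apply: cP => //; rewrite distrC ger0_norm; lra.
  have [u [v [qu qv uv]]] : exists u v, [/\ between (q (p s)) u (q (p t)),
      between (q (p s)) v (q (p t)) & c - d <= `|iter m.+1 f u - iter m.+1 f v|].
    have [/andP[? ?] /andP[? ?]] := (pI s, pI t).
    have [ps|ps] := leP (p s) (p t).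
      rewrite distrC ger0_norm ?subr_ge0 // in cst.
      have [|||u [v [qu qv uv]]] := qosc (p s) (p t); [lra..|].
      by exists u, v; split => //; lra.
    rewrite gtr0_norm ?subr_gt0 // in cst.
    have [|||u [v [qu qv uv]]] := qosc (p t) (p s); [lra..|].
    by exists u, v; split; [rewrite /between orbC|rewrite /between orbC|lra].
  have qpc : continuous (q \o p).
    by apply: unif_cont_continuous; have [] := param_comp qp pp.
  have [|u' su' Eu] := @ivt R (q \o p) s t u qpc _ qu; first lra.
  have [|v' sv' Ev] := @ivt R (q \o p) s t v qpc _ qv; first lra.
  exists u', v'; split => //; move: Eu Ev => /= -> ->; lra.
Qed.

Lemma exists_stages : exists S : nat -> stage,
  (forall i, valid (S i)) /\ forall i, refines i (S i) (S i.+1).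
Proof.
have [m slm] := sl ltr01.
have v0 : valid (Stage 0 m 1 (@clamp R)).
  by split => //=; [exact: param_clamp | rewrite subn0].
have /choice[c cP] (q : nat * stage) : exists T, valid q.2 -> valid T /\ refines q.1 q.2 T.
  have [V|NV] := pselect (valid q.2); last by exists q.2.
  by have [T TP] := refine q.1 V; exists T.
pose S := fix S i := if i is j.+1 then c (j, S j) else Stage 0 m 1 (@clamp R).
have SV i : valid (S i).
  by elim: i => // i IH; exact: (cP (i, S i) IH).1.
by exists S; split => // i; exact: (cP (i, S i) (SV i)).2.
Qed.

(** Unless the value at [y] lies between the end values, the intermediate value theorem cuts out a
    true loop around [y]; uniform continuity of the [m]-th iterate covers the rest. *)
Lemma near_loops m e : 0 < e -> small_loops f m e -> exists2 d : R, 0 < d &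
  forall j x y z, 0 <= x -> x <= y -> y <= z -> z <= 1 ->
    `|iter j f x - iter j f z| <= d ->
    `|iter (m + j) f y - iter (m + j) f x| <= 2 * e.
Proof.
move=> e0 H; have [d d0 dP] := unif_cont_iter m fu e0.
exists d => // j x y z x0 xy yz z1 xzd; rewrite !iterD.
have jc : continuous (iter j f) by exact: iter_continuous.
set p := iter j f x in xzd *; set q := iter j f z in xzd; set w := iter j f y.
have [C|[C|C]] : between p w q \/ between p q w \/ between q p w.
  by rewrite /between; have [?|/ltW ?] := leP p q; have [?|/ltW ?] := leP p w;
    have [?|/ltW ?] := leP q w; lra.
- have wp : `|w - p| <= d.
    by apply: le_trans xzd; move: C => /orP[] C; rewrite ler_norml;
      have := ler_norm (p - q); have := ler_norm (q - p); rewrite (distrC q p); lra.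
  by have := dP _ _ wp; lra.
- have [x' /andP[xx' x'y] Ex] := ivt jc xy C.
  have x'0 : 0 <= x' by lra.
  have := H j x' y z x'0 x'y yz z1 Ex; rewrite !iterD Ex -/q -/w => D1.
  have := dP _ _ xzd; have := ler_distD (iter m f q) (iter m f w) (iter m f p).
  by rewrite (distrC (iter m f q)); lra.
- have [|z' /andP[yz' z'z] Ez] := @ivt R (iter j f) y z p jc yz.
    by rewrite orbC; exact: C.
  have z'1 : z' <= 1 by lra.
  have := H j x y z' x0 xy yz' z'1 (esym Ez); rewrite !iterD -/p -/w; lra.
Qed.

Lemma exists_parametrization : exists phi : nat -> R -> R, [/\
  forall k, unif_cont (phi k),
  forall k s, 0 <= phi k s <= 1,
  forall k s, f (phi k.+1 s) = phi k s,
  forall x : nat -> R, (forall k, 0 <= x k <= 1) -> (forall k, f (x k.+1) = x k) ->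
    exists2 s, 0 <= s <= 1 & forall k, phi k s = x k &
  forall s t, 0 <= s <= 1 -> 0 <= t <= 1 -> (forall k, phi k s = phi k t) -> s = t].
Proof.
have [S [SV SR]] := exists_stages.
pose n i := level (S i); pose tau i := tol (S i); pose psi i := chart (S i).
(* The [i]-th approximation of the coordinate [k], meaningful only for [k <= n i] because the
   subtraction truncates. *)
pose a i k s := iter (n i - k) f (psi i s).
have tau0 i : 0 < tau i by have [] := SV i.
have tauS i : tau i.+1 <= tau i / 2 by have [] := SR i.
have nS i : (n i < n i.+1)%N by have [] := SR i.
have nlt i j : (i < j)%N -> (n i < n j)%N.
  elim: j => // j IH; rewrite ltnS leq_eqVlt => /orP[/eqP -> //|/IH ij].
  exact: ltn_trans ij (nS j).
have nge i : (i <= n i)%N by elim: i => // i IH; exact: leq_ltn_trans IH (nS i).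
have small (e : R) : 0 < e -> exists i0, forall i, (i0 <= i)%N -> tau i <= e.
  move=> e0.
  have tauH i : tau i <= tau 0%N * i.+1%:R^-1.
    elim: i => [|i IH]; first by rewrite invr1 mulr1.
    apply: le_trans (tauS i) _; apply: (@le_trans _ _ (tau 0%N * i.+1%:R^-1 / 2)).
      by rewrite ler_wpM2r // invr_ge0.
    rewrite -mulrA ler_wpM2l ?(ltW (tau0 _)) // -invfM lef_pV2 ?posrE //.
    by rewrite -natrM ler_nat muln2 -addnn addSn ltnS leq_addl.
  have e1 : 0 < e / tau 0%N by rewrite divr_gt0.
  have [N /= NP] := ltr_add_invr e1; exists N => i Ni.
  apply: le_trans (tauH i) _; rewrite mulrC -ler_pdivlMr //.
  rewrite add0r in NP; apply: le_trans (ltW NP).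
  by rewrite lef_pV2 ?posrE // ler_nat ltnS.
have [psiu psiI] : (forall i, unif_cont (psi i)) /\ forall i s, 0 <= psi i s <= 1.
  by apply: all_and2 => i; have [_ _ [? ? _ _ _] _] := SV i.
have aI i k s : 0 <= a i k s <= 1 by exact: iter_I.
have au i k : unif_cont (a i k) by exact: unif_cont_comp (unif_cont_iter _ fu) (psiu i).
have /choice[phi2 phi2P] (q : nat * R) : exists l : R, forall i, (q.1 <= n i)%N ->
    `|l - a i.+1 q.1 q.2| <= 4 * tau i.+1.
  (* The index is shifted because stage [i.+1] controls only levels up to its previous level
     [n i]. *)
  apply: (@quasi_cauchy _ (fun i => q.1 <= n i)%N (fun i => a i.+1 q.1 q.2)
     (fun i => tau i.+1)) => //.
  - by exists q.1.
  - by move=> i qi; exact: leq_trans qi (ltnW (nS i)).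
  - move=> i qi; have [_ _ _ E _] := SR i.+1.
    by apply: E; have [-> _ _ _ _] := SR i.
pose phi k s := phi2 (k, s).
have phiP i k s : (k <= n i)%N -> `|phi k s - a i.+1 k s| <= 4 * tau i.+1.
  exact: (phi2P (k, s) i).
clearbody phi.
have approx k (e : R) : 0 < e -> exists i0, forall i s, (i0 <= i)%N ->
    [/\ (k <= n i)%N & `|phi k s - a i k s| <= e].
  move=> e0; have [|i0 i0P] := small (e / 4); first lra.
  exists (maxn k i0).+1 => -[//|i] s; rewrite ltnS geq_max => /andP[ki ii].
  have kn := leq_trans ki (nge i); split; first exact: leq_trans kn (ltnW (nS i)).
  apply: le_trans (phiP i k s kn) _.
  by have := i0P i.+1 (leqW ii); lra.
have phiE (x y : R) : (forall e : R, 0 < e -> `|x - y| <= e) -> x = y.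
  move=> H; apply/eqP; rewrite -subr_eq0 -normr_le0; apply/ler_addgt0Pr => e e0.
  by rewrite add0r H.
have phiu k : unif_cont (phi k).
  move=> e e0; have [|i iP] := approx k (e / 3); first lra.
  have [|d d0 dP] := au i k (e / 3); first lra.
  exists d => // x y /dP xy.
  have [_ ix] := iP i x (leqnn i); have [_ iy] := iP i y (leqnn i).
  have := ler_distD (a i k x) (phi k x) (phi k y).
  have := ler_distD (a i k y) (a i k x) (phi k y).
  by rewrite (distrC (a i k y) (phi k y)); lra.
have phiI k s : 0 <= phi k s <= 1.
  apply/andP; split; apply/ler_addgt0Pr => e e0.
    have [i /(_ i s (leqnn i))[_]] := approx k e e0.
    by have := aI i k s; rewrite ler_norml; lra.
  have [i /(_ i s (leqnn i))[_]] := approx k e e0.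
  by have := aI i k s; rewrite ler_norml; lra.
have phif k s : f (phi k.+1 s) = phi k s.
  apply: phiE => e e0.
  have [|d d0 dP] := fu (e := e / 2); first lra.
  have [i1 i1P] := approx k.+1 d d0.
  have [|i2 i2P] := approx k (e / 2); first lra.
  have [k1 E1] := i1P (maxn i1 i2) s (leq_maxl _ _).
  have [_ E2] := i2P (maxn i1 i2) s (leq_maxr _ _).
  move: (maxn i1 i2) k1 E1 E2 => i k1 E1 E2.
  have fa : f (a i k.+1 s) = a i k s.
    by rewrite /a -iterS subnSK.
  have := dP _ _ E1; rewrite fa.
  have := ler_distD (a i k s) (f (phi k.+1 s)) (phi k s).
  by rewrite (distrC (a i k s) (phi k s)); lra.
exists phi; split => //.
- move=> x xI xf.
  (* The chart of stage [i] hits [x] exactly in level [n i], hence in all lower levels; a cluster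
     point of these parameters represents [x]. *)
  have /choice[s sP] i : exists s, 0 <= s <= 1 /\ psi i s = x (n i).
    have [_ _ [_ _ ps _ _] _] := SV i.
    by have [s sI sE] := ps _ (xI (n i)); exists s.
  have sI i := (sP i).1; have sE i := (sP i).2.
  have [l [l' [lI _ lP]]] := cluster_pair sI sI.
  exists l => // k; apply: phiE => e e0.
  have [|d d0 dP] := phiu k (e / 2); first lra.
  have [|i0 i0P] := approx k (e / 2); first lra.
  have [i [ii il _]] := lP d i0 d0.
  have [kn E1] := i0P i (s i) ii.
  have := dP _ _ (ltW il).
  have xE : a i k (s i) = x k.
    rewrite /a sE -{2}(subnK kn); move: (n i - k)%N => j.
    by elim: j => [|j IH]; rewrite ?iterSr ?addSn ?xf.
  rewrite xE in E1.
  have := ler_distD (phi k (s i)) (phi k l) (x k).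
  by rewrite (distrC (phi k l) (phi k (s i))); lra.
- suff H s t : 0 <= s -> s < t -> t <= 1 -> (forall k, phi k s = phi k t) -> False.
    move=> s t /andP[s0 s1] /andP[t0 t1] E; have [st|ts|//] := ltgtP s t.
      by case: (H s t).
    by case: (H t s).
  move=> s0 st t1 E.
  have st0 : 0 < t - s by rewrite subr_gt0.
  have [i /= iP] := ltr_add_invr st0; rewrite add0r in iP.
  have [_ _ _ _ osc] := SR i.
  have [|u0 [v0 [su0 sv0 uv0]]] := osc s t s0 t1; first by move: (_^-1) iP => c; lra.
  pose K := n i; pose e := tau i.+1.
  have e0 : 0 < e by exact: tau0.
  (* Of the oscillation [20 * e] each end loses [4 * e], so [12 * e] remains, and [u0] or [v0] is
     [6 * e] away from the value at [s]. *)
  have [u su uE] : exists2 u, s <= u <= t & 6 * e <= `|phi K u - phi K s|.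
    have Ku := phiP i K u0 (leqnn _); have Kv := phiP i K v0 (leqnn _).
    have big : 12 * e <= `|phi K u0 - phi K v0|.
      have := ler_distD (phi K u0) (a i.+1 K u0) (a i.+1 K v0).
      have := ler_distD (phi K v0) (phi K u0) (a i.+1 K v0).
      rewrite (distrC (a i.+1 K u0) (phi K u0)).
      move: uv0 Ku Kv; rewrite -/e /a -/(n i) -/(n i.+1) -/(psi i.+1) -/(tau i.+1) -/e -/K.
      by lra.
    have [?|?] := leP (6 * e) `|phi K u0 - phi K s|; first by exists u0.
    exists v0 => //; have := ler_distD (phi K s) (phi K u0) (phi K v0).
    by rewrite (distrC (phi K s) (phi K v0)); lra.
  have [m slm] := sl e0.
  (* Equal coordinates at [s] and [t] make the chart image of [[s, t]] almost a loop down to level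
     [m + K]. In level [K] it stays within [2 * e] of an end value, and two approximation errors
     [e / 2] do not reach [6 * e]. *)
  have [d d0 dP] := near_loops e0 slm.
  have [|i1 i1P] := approx (m + K)%N (d / 2); first lra.
  have [|i2 i2P] := approx K (e / 2); first lra.
  pose l := maxn i1 i2.
  have B1 w := i1P l w (leq_maxl _ _).
  have B2 w := i2P l w (leq_maxr _ _).
  have mKl : (m + K <= n l)%N by have [] := B1 s.
  clearbody l.
  pose j := (n l - (m + K))%N.
  have aj w : a l (m + K)%N w = iter j f (psi l w) by [].
  have amj w : a l K w = iter (m + j) f (psi l w).
    rewrite /a /j [(m + K)%N]addnC subnDA subnKC //.
    by rewrite leq_subRL ?(leq_trans (leq_addl _ _) mKl) // addnC.
  have close : `|iter j f (psi l s) - iter j f (psi l t)| <= d.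
    have [_] := B1 s; have [_] := B1 t; rewrite -!aj E.
    have := ler_distD (phi (m + K)%N t) (a l (m + K)%N s) (a l (m + K)%N t).
    by rewrite (distrC (a l (m + K)%N s) (phi (m + K)%N t)); lra.
  have [_ _ [_ _ _ _ pm] _] := SV l.
  have [_ Bu] := B2 u; have [_ Bs] := B2 s; have [_ Bt] := B2 t.
  have [/andP[? ?] /andP[? ?]] := (psiI l s, psiI l t).
  case/andP: su => su ut; have /orP[] := pm s u t s0 su ut t1 => /andP[p1 p2].
    have := dP j (psi l s) (psi l u) (psi l t) ltac:(by []) p1 p2 ltac:(by []) close.
    rewrite -!amj.
    have := ler_distD (a l K u) (phi K u) (phi K s).
    have := ler_distD (a l K s) (a l K u) (phi K s).
    by rewrite (distrC (a l K s) (phi K s)); lra.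
  rewrite distrC in close.
  have := dP j (psi l t) (psi l u) (psi l s) ltac:(by []) p1 p2 ltac:(by []) close.
  rewrite -!amj; rewrite E in uE.
  have := ler_distD (a l K u) (phi K u) (phi K t).
  have := ler_distD (a l K t) (a l K u) (phi K t).
  by rewrite (distrC (a l K t) (phi K t)); lra.
Qed.

End Parametrization.

(** * Coordinates on an arc *)

Section Arcs.
Variable R : realType.
Implicit Types (f g : R -> R) (x : nat -> R) (s t e : R).

Lemma continuous_comp_clamp (T : topologicalType) (h : R -> T) :
  {within cI 0 1, continuous h} -> continuous (h \o @clamp R).
Proof.
move=> /subspace_continuousP hc s W /(hc (clamp s) (clampI s)) hW.
have H : \forall t \near s, cI 0 1 (clamp t) -> W (h (clamp t)).
  exact: unif_cont_continuous (@unif_cont_clamp R) _ _ hW.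
suff : \forall t \near s, W (h (clamp t)) by [].
by apply: filterS H => t; apply; exact: clampI.
Qed.

(** Preimages are chosen upwards from level [n], so [y j] lies in level [n + j]; applying [f] to it
    [n] times gives level [j]. *)
Lemma thread_through f (A : nat -> set R) n t : (forall k, f @` A k.+1 = A k) ->
  A n t -> exists x, x n = t /\ forall k, A k (x k) /\ f (x k.+1) = x k.
Proof.
move=> fA At.
have /choice[c cP] (q : nat * R) : exists r, A q.1 q.2 -> A q.1.+1 r /\ f r = q.2.
  have [Aq|] := pselect (A q.1 q.2); last by exists 0.
  by move: Aq; rewrite -fA => -[r Ar fr]; exists r.
pose y := fix y j := if j is i.+1 then c ((n + i)%N, y i) else t.
have yA j : A (n + j)%N (y j).
  by elim: j => [|j IH]; rewrite ?addn0 // addnS; exact: (cP (_, _) IH).1.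
have yf j : f (y j.+1) = y j by exact: (cP (_, _) (yA j)).2.
have iterA m k s : A (m + k)%N s -> A k (iter m f s).
  elim: m s => [|m IH] s //; rewrite addSn iterSr => As; apply: IH.
  by rewrite -fA; exists s.
exists (fun k => iter n f (y k)); split.
  have down j : iter j f (y j) = t by elim: j => // j IH; rewrite iterSr yf.
  exact: down.
by move=> k; split; [exact: iterA|rewrite -iterS iterSr yf].
Qed.

(** A parametrization of the inverse limit by [[0, 1]], given through real coordinate functions
    instead of a map into the product. *)
Definition arc_coordinates f (phi : nat -> R -> R) := [/\
  forall k, continuous (phi k),
  forall k s, 0 <= phi k s <= 1,
  forall k s, f (phi k.+1 s) = phi k s,
  forall x, (forall k, 0 <= x k <= 1) -> (forall k, f (x k.+1) = x k) ->
    exists2 s, 0 <= s <= 1 & forall k, phi k s = x k &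
  forall s t, 0 <= s <= 1 -> 0 <= t <= 1 -> (forall k, phi k s = phi k t) -> s = t].

(** Otherwise pairs of parameters at distance at least [e], with more and more coordinates nearly
    equal, accumulate at two distinct parameters of one point. *)
Lemma arc_coordinates_separate f phi : arc_coordinates f phi ->
  forall e, 0 < e -> exists N, exists2 c : R, 0 < c &
    forall s t, 0 <= s <= 1 -> 0 <= t <= 1 ->
      (forall k, (k <= N)%N -> `|phi k s - phi k t| < c) -> `|s - t| < e.
Proof.
move=> [phic _ _ _ inj] e e0; apply: contrapT => H.
have /choice[q qP] n : exists q : R * R, [/\ 0 <= q.1 <= 1, 0 <= q.2 <= 1,
    forall k, (k <= n)%N -> `|phi k q.1 - phi k q.2| < n.+1%:R^-1 & e <= `|q.1 - q.2|].
  apply: contrapT => H'; apply: H; exists n, n.+1%:R^-1; first by rewrite invr_gt0.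
  move=> s t sI tI st; rewrite ltNge; apply/negP => est.
  by apply: H'; exists (s, t).
have [a [b [aI bI ab]]] := @cluster_pair R (fst \o q) (snd \o q)
  (fun n => let: And4 p _ _ _ := qP n in p) (fun n => let: And4 _ p _ _ := qP n in p).
have eq_ab : a = b.
  apply: inj => // k.
  have close (d : R) : 0 < d -> `|phi k a - phi k b| <= d.
    move=> d0; have d3 : 0 < d / 3 by lra.
    have /cvgrPdist_lt/(_ _ d3)/nbhs_ballP[r1 /= r10 r1P] := phic k a.
    have /cvgrPdist_lt/(_ _ d3)/nbhs_ballP[r2 /= r20 r2P] := phic k b.
    have [N /= NP] := ltr_add_invr d3; rewrite add0r in NP.
    have [|n [Nn na nb]] := ab (Num.min r1 r2) (maxn N k); first by rewrite lt_min r10.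
    move: Nn na nb; rewrite geq_max !lt_min /= => /andP[Nn kn] /andP[na _] /andP[_ nb].
    have [_ _ /(_ k kn) qn _] := qP n.
    have nN : n.+1%:R^-1 <= N.+1%:R^-1 :> R by rewrite lef_pV2 ?posrE // ler_nat ltnS.
    have {}qn := lt_le_trans qn (le_trans nN (ltW NP)).
    have := r1P (q n).1; rewrite /ball/= distrC => /(_ na).
    have := r2P (q n).2; rewrite /ball/= distrC => /(_ nb).
    have := ler_distD (phi k (q n).1) (phi k a) (phi k b).
    have := ler_distD (phi k (q n).2) (phi k (q n).1) (phi k b).
    rewrite (distrC (phi k (q n).2) (phi k b)); lra.
  apply/eqP; rewrite -subr_eq0 -normr_le0; apply/ler_addgt0Pr => d d0.
  by rewrite add0r; exact: close.
have e2 : 0 < e / 2 by lra.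
have [n [_ /= na nb]] := ab (e / 2) 0%N e2.
have [_ _ _ qe] := qP n.
have := ler_distD a (q n).1 (q n).2.
by rewrite (distrC a) {2}eq_ab; lra.
Qed.

(** The [n]-th coordinate determines all lower ones, and finitely many coordinates separate
    parameters. *)
Lemma arc_coordinates_inj f phi : arc_coordinates f phi ->
  forall e, 0 < e -> exists N, forall n, (N <= n)%N -> forall s t,
    0 <= s <= 1 -> 0 <= t <= 1 -> phi n s = phi n t -> `|s - t| < e.
Proof.
move=> ac e e0; have [N [c c0 cP]] := arc_coordinates_separate ac e0.
exists N => n Nn s t sI tI E; apply: cP => // k kN.
have [_ _ phif _ _] := ac.
have down j u : iter j f (phi (j + k)%N u) = phi k u.
  by elim: j => // j IH; rewrite iterSr addSn phif.
have kn := leq_trans kN Nn.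
by rewrite -!(down (n - k)%N) subnK // E subrr normr0.
Qed.

Lemma arc_coordinates_is_arc f phi : arc_coordinates f phi -> is_arc (R := R) (inv_lim f).
Proof.
move=> ac; have [phic phiI phif surj inj] := ac.
pose h s : {ptws nat -> R} := fun k => phi k s.
have hX s : inv_lim f (h s) by split => k; [exact: phiI|exact: phif].
have /choice[g gP] (x : {ptws nat -> R}) : exists s, inv_lim f x ->
    0 <= s <= 1 /\ h s = x.
  have [[xI xf]|nx] := pselect (inv_lim f x); last by exists 0.
  have [s sI sE] := surj x xI xf; exists s => _; split => //.
  by apply/funext.
exists h, g; split; [|split; [|split; [|split; [|split]]]].
- apply: continuous_subspaceT => s.
  by apply/pointwise_cvgP => k; exact: phic.
- apply/subspace_continuousP => x Xx; apply/cvgrPdist_lt => e e0.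
  have [N [c c0 cP]] := arc_coordinates_separate ac e0.
  have [gI gE] := gP x Xx.
  have near_x : \forall y \near nbhs x, forall k, (k <= N)%N -> `|x k - y k| < c.
    have pc k : \forall y \near nbhs x, `|x k - y k| < c.
      have xx : nbhs x --> x by exact: cvg_id.
      by have /pointwise_cvgP/(_ k)/cvgrPdist_lt/(_ _ c0) := xx.
    elim: N {cP} => [|N IH].
      by apply: filterS (pc 0%N) => y yc k; rewrite leqn0 => /eqP ->.
    apply: filterS2 IH (pc N.+1) => y yN yc k.
    by rewrite leq_eqVlt => /orP[/eqP ->//|/yN].
  apply: filterS near_x => y yc Xy; have [gyI gyE] := gP y Xy.
  apply: cP => // k kN; move: (yc k kN); rewrite -{1}gE -{1}gyE.
  by [].
- by move=> s _; exact: hX.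
- by move=> x /gP[].
- move=> s sI; have [gI gE] := gP _ (hX s).
  by apply: inj => // k; exact: (congr1 (@^~ k) gE).
- by move=> x /gP[].
Qed.

Lemma is_arc_coordinates f : is_arc (R := R) (inv_lim f) -> exists phi, arc_coordinates f phi.
Proof.
move=> [h [g [hc [_ [hX [gI [gh hg]]]]]]].
exists (fun k s => h (clamp s) k).
have hcc := continuous_comp_clamp hc.
have X s : inv_lim f (h (clamp s)) by apply: hX; exact: clampI.
split.
- move=> k s; apply: (@continuous_comp _ _ _ (h \o @clamp R) (@proj nat (fun=> R) k)).
    exact: hcc.
  exact: proj_continuous.
- by move=> k s; exact: (X s).1.
- by move=> k s; exact: (X s).2.
- move=> x xI xf; have Xx : inv_lim f x by split.
  exists (g x); first exact: gI.
  by move=> k; rewrite clamp_id ?hg //; exact: gI.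
- move=> s t sI tI; rewrite !clamp_id // => E.
  by rewrite -[s]gh // -[t]gh //; congr g; apply/funext.
Qed.

Lemma arc_no_splitting f : (forall s, 0 <= f s <= 1) ->
  (forall s, 0 <= s <= 1 -> exists2 t, 0 <= t <= 1 & f t = s) ->
  is_arc (R := R) (inv_lim f) -> ~ admits_splitting_sequence f.
Proof.
move=> fI fs /is_arc_coordinates[phi ac] [l [r [[lr [fT [m lt_lr]]] [N [a [b [Ninf NP]]]]]]].
have [phic phiI phif surj inj] := ac.
have TI n t : cI (l n) (r n) t -> 0 <= t <= 1.
  by have [l0 [_ [r1 _]]] := lr n; rewrite /cI/=; lra.
(* The parameters of the subcontinuum determined by the tight sequence. *)
pose T s := 0 <= s <= 1 /\ forall n, cI (l n) (r n) (phi n s).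
have lift n t : cI (l n) (r n) t -> exists2 s, T s & phi n s = t.
  move=> /(thread_through (A := fun n => cI (l n) (r n)) fT)[x [<- xP]].
  have [|k|s sI sx] := surj x; [by move=> k; apply: TI; exact: (xP k).1|exact: (xP k).2|].
  by exists s => //; split => // k; rewrite sx; exact: (xP k).1.
have liftI n t : 0 <= t <= 1 -> exists2 s, 0 <= s <= 1 & phi n s = t.
  have fA (k : nat) : f @` cI 0 1 = cI 0 1.
    rewrite eqEsubset; split => [_ [u uI <-]|u /fs[v vI <-]]; first exact: fI.
    by exists v.
  move=> tI; have [x [<- xP]] := @thread_through f (fun=> cI 0 1) n t fA tI.
  have [|k|s sI sx] := surj x; [by move=> k; exact: (xP k).1|exact: (xP k).2|].
  by exists s.
have Tclosed : closed [set s | T s].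
  have -> : [set s | T s] = `[0, 1]%classic `&`
      \bigcap_n (phi n @^-1` `[l n, r n]%classic).
    rewrite eqEsubset; split => s /=.
      by move=> [sI sT]; split; rewrite /= ?in_itv //= => n _ /=; rewrite in_itv/=; exact: sT.
    rewrite in_itv/= => -[sI sT]; split => // n.
    by have := sT n I; rewrite /= in_itv.
  apply: closedI; first exact: interval_closed.
  apply: closed_bigI => n _; apply: closed_comp; last exact: interval_closed.
  by move=> s _; exact: phic.
have Tcompact (A : set R) : closed A -> compact ([set s | T s] `&` A).
  move=> cA; apply: (subclosed_compact _ (@segment_compact R 0 1)); first exact: closedI.
  by move=> s [[sI _] _] /=; rewrite in_itv.
(* At a gap [u] of [T], the parts of [T] on both sides would project, in a high level [n], to
   disjoint closed sets covering the connected [[l n, r n]]. *)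
have Tconvex s u t : T s -> T t -> s < u -> u < t -> T u.
  move=> Ts Tt su ut; have uI : 0 <= u <= 1 by case: Ts => sI _; case: Tt => tI _; lra.
  split => // k; apply: contrapT => Nu.
  have [e e0 eP] : exists2 e : R, 0 < e & forall v, `|u - v| < e -> ~ T v.
    have oc : open (phi k @^-1` (~` `[l k, r k]%classic)).
      apply: open_comp; first by move=> v _; exact: phic.
      by apply: closed_openC; exact: interval_closed.
    have : nbhs u (phi k @^-1` (~` `[l k, r k]%classic)).
      by apply: open_nbhs_nbhs; split => //=; rewrite in_itv.
    move=> /nbhs_ballP[e /= e0 eP]; exists e => // v uv [_ /(_ k) Tv].
    by apply: (eP v uv); rewrite /= in_itv.
  have [n nP] := arc_coordinates_inj ac e0.
  pose A := phi n @` ([set s | T s] `&` [set v | v <= u]).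
  pose B := phi n @` ([set s | T s] `&` [set v | u <= v]).
  have clo (C : set R) : closed C -> closed (phi n @` ([set s | T s] `&` C)).
    move=> cC; apply: compact_closed; first exact: Rhausdorff.
    apply: continuous_compact (Tcompact _ cC).
    by apply: continuous_subspaceT; exact: phic.
  have disj v w : T v -> T w -> v <= u -> u <= w -> phi n v <> phi n w.
    move=> Tv Tw vu uw E.
    have := nP n (leqnn n) v w Tv.1 Tw.1 E.
    have [uv|uv] := ltP `|u - v| e; first by case: (eP _ uv).
    rewrite ger0_norm ?subr_ge0 // in uv.
    by rewrite distrC ger0_norm; lra.
  have cover y : cI (l n) (r n) y -> A y \/ B y.
    move=> /lift[v Tv <-]; have [vu|uv] := leP v u.
      by left; exists v.
    by right; exists v => //; split => //=; exact: ltW.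
  have Aeq : A = `[l n, r n]%classic.
    apply: (@segment_connected R (l n) (r n)).
    - by exists (phi n s), s => //; split => //=; exact: ltW.
    - exists (~` B); first by apply: closed_openC; apply: clo; exact: closed_ge.
      rewrite eqEsubset; split => [_ [v [Tv vu] <-]|y [yI nB]].
        split; first by rewrite /= in_itv; exact: Tv.2.
        by move=> [w [Tw uw] E]; apply: (disj v w) => //; rewrite E.
      by have [] := cover y; first by move: yI; rewrite /= in_itv.
    - exists A; first by apply: clo; exact: closed_le.
      rewrite eqEsubset; split => [y [v [Tv vu] E]|y [//]]; split; last by exists v.
      by rewrite /= in_itv -E; exact: Tv.2.
  have : A (phi n t) by rewrite Aeq /= in_itv; exact: Tt.2.
  move=> [w [Tw wu] E]; apply: (disj w t) => //; exact: ltW.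
have [x [y [Tx Ty xy]]] : exists x y : R, [/\ T x, T y & x < y].
  have lrm := lt_lr m.+1 (ltnSn m).
  have [|x Tx Ex] := lift m.+1 (l m.+1); first by rewrite /cI/= lexx ltW.
  have [|y Ty Ey] := lift m.+1 (r m.+1); first by rewrite /cI/= lexx ltW.
  have [xy|yx|E] := ltgtP x y; [by exists x, y|by exists y, x|].
  by move: lrm; rewrite -Ex -Ey E ltxx.
(* With a third, [x + eta] and [y - eta] are [eta] apart and at least [eta] away from [x] and
   [y]. *)
pose eta := (y - x) / 3.
have eta0 : 0 < eta by rewrite /eta; lra.
have [n0 n0P] := arc_coordinates_inj ac eta0.
have /infinite_natP/(_ n0.+1)[[//|n] Nn nn0] := Ninf.
have [a0 ab b1 STend fST] := NP _ Nn.
have lrn1 := lr n.+1.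
(* A point [w] over [s] agrees with [p] in level [n], so it is [eta]-close to [p] and still between
   [x] and [y]; by convexity it is in [T], which puts [s] into the interval of level [n.+1]. *)
have probe p : `|p - x| <= 2 * eta -> `|p - y| <= 2 * eta -> 0 <= p <= 1 ->
    exists2 s, (cI (a n.+1) (b n.+1) `&` cI (l n.+1) (r n.+1)) s & f s = phi n p.
  move=> px py pI.
  have [xI _] := Tx; have [yI _] := Ty.
  move: px py; rewrite !ler_norml => px py.
  have pT : T p by apply: (Tconvex x p y) => //; rewrite /eta in px py *; lra.
  have : (f @` cI (a n.+1) (b n.+1)) (phi n p) by rewrite fST fT; exact: pT.2.
  move=> [s sS fsp]; exists s => //; split => //.
  have sI : 0 <= s <= 1 by move: sS; rewrite /cI/=; lra.
  have [w wI ws] := liftI n.+1 s sI.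
  have wp : `|w - p| < eta by apply: (n0P n) => //; rewrite -phif ws.
  rewrite -ws; have [_ ] : T w; last exact.
  by apply: (Tconvex x w y) => //; move: wp; rewrite ltr_norml /eta; rewrite /eta in px py; lra.
have [xI yI] := (Tx.1, Ty.1).
have [|||s sST fsE] := probe (x + eta).
- by rewrite ler_norml /eta; lra.
- by rewrite ler_norml /eta; lra.
- by rewrite /eta; lra.
have [|||t tST ftE] := probe (y - eta).
- by rewrite ler_norml /eta; lra.
- by rewrite ler_norml /eta; lra.
- by rewrite /eta; lra.
have [E|st] := eqVneq s t.
  have := n0P n nn0 (x + eta) (y - eta).
  rewrite -fsE -ftE E => /(_ _ _ erefl); rewrite ltr_norml /eta; lra.
(* Two distinct common points and their midpoint cannot all be among two end points. *)
have mST : (cI (a n.+1) (b n.+1) `&` cI (l n.+1) (r n.+1)) ((s + t) / 2).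
  by case: sST tST => + + []; rewrite /cI/=; lra.
move: (STend _ sST) (STend _ tST) (STend _ mST) st => /= [->|->] [->|->] M /eqP; lra.
Qed.

Lemma no_splitting_arc f : unif_cont f -> (forall s, 0 <= f s <= 1) ->
  (forall s, 0 <= s <= 1 -> exists2 t, 0 <= t <= 1 & f t = s) ->
  ~ admits_splitting_sequence f -> is_arc (R := R) (inv_lim f).
Proof.
move=> fu fI fs nosplit.
have [|phi [phiu phiI phif surj inj]] := exists_parametrization fu fI fs.
  by move=> e; exact: exists_small_loops.
apply: (@arc_coordinates_is_arc f phi); split => // k.
exact: unif_cont_continuous.
Qed.

Lemma eq_admits_splitting_sequence f g : (forall s, 0 <= s <= 1 -> f s = g s) ->
  admits_splitting_sequence f -> admits_splitting_sequence g.
Proof.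
move=> fg [l [r [[lr [fT lt_lr]] [N [a [b [Ninf NP]]]]]]].
have im c d : 0 <= c -> d <= 1 -> g @` cI c d = f @` cI c d.
  by move=> c0 d1; apply: eq_imagel => s /andP[cs sd]; rewrite fg //; lra.
have imT n : g @` cI (l n) (r n) = f @` cI (l n) (r n).
  by have [? [_ [? _]]] := lr n; exact: im.
exists l, r; split; first by split => //; split => // n; rewrite imT.
exists N, a, b; split => // n /NP[a0 ab b1 sub E]; split => //.
by rewrite imT im.
Qed.

End Arcs.

Unset Implicit Arguments.

Theorem theorem4p7 (R : realType) (f : R -> R)
  (f_maps : forall x, 0 <= x <= 1 -> 0 <= f x <= 1)
  (f_cont : {within cI 0 1, continuous f})
  (f_surj : forall y, 0 <= y <= 1 -> exists2 x, 0 <= x <= 1 & f x = y) :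
  is_arc (R := R) (inv_lim f) <-> ~ admits_splitting_sequence f.
Proof.
(* [g] agrees with [f] on [[0, 1]], which is all that both sides of the equivalence depend on, and
   is uniformly continuous on the line. *)
pose g := f \o @clamp R.
have fg s : 0 <= s <= 1 -> f s = g s by move=> sI; rewrite /g /= clamp_id.
have gu : unif_cont g.
  have := heine (continuous_comp_clamp f_cont).
  suff -> : (f \o @clamp R) \o @clamp R = g by [].
  by apply/funext => s /=; rewrite (clamp_id (clampI s)).
have gI s : 0 <= g s <= 1 by apply: f_maps; exact: clampI.
have gs s : 0 <= s <= 1 -> exists2 t, 0 <= t <= 1 & g t = s.
  by move=> /f_surj[t tI <-]; exists t => //; rewrite -fg.
have -> : inv_lim f = inv_lim g.
  by rewrite eqEsubset; split => x [xI xf]; split => // n; have := xf n; rewrite fg.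
split=> [Xarc /(eq_admits_splitting_sequence fg)|H].
  exact: arc_no_splitting Xarc.
apply: no_splitting_arc => // /eq_admits_splitting_sequence gS; apply: H; apply: gS.
by move=> s sI; rewrite fg.
Qed.
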